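(* Let $T=(T_m)_{m\in\mathbb Z}$ be an ergodic (probability preserving) $\mathbb Z$-action of quasi-exact finite rank. Then $T$ is partially rigid.
   Context: Measure spaces are standard and non-atomic. **Rank at most $k$.** A probability preserving $\mathbb Z$-action $T$ on $(X,\mathfrak B,\mu)$ is of rank at most $k$ if there are sequences $(B_n^j)_{n\ge0}$, $j=1,\dots,k$, of measurable subsets and sets $F_n^j=\{0,1,\dots,\#F_n^j-1\}$ such that: (i) for each $n$, the sets $T_gB_n^j$, $g\in F_n^j$, $1\le j\le k$, are pairwise disjoint; (ii) for each $B\in\mathfrak B$, $\lim_{n\to\infty}\inf_{F^j\subset F_n^j}\mu\big(B\triangle\bigsqcup_{j=1}^k\bigsqcup_{g\in F^j}T_gB_n^j\big)=0$. The collection $\{T_gB_n^j: g\in F_n^j\}$ is the $j$-th $T$-tower of the $n$-th $T$-castle, its members are levels, and $W_n^j$ is the union of its levels; the $n$-th $T$-castle is the collection of these $k$ towers. The sequence of castles refines if for each $n$ every level of the $n$-th castle is a union of levels of the $(n+1)$-th castle. In this case each tower of the $(n+1)$-th castle is a stack of (sub-tower) copies of towers of the $n$-th castle together with additional levels (spacers) not belonging to any tower of the $n$-th castle. **Quasi-exact rank at most $k$**: there are sequences $(B_n^j)_{n\ge0}$ of measurable subsets and sets $F_n^j=\{0,1,\dots,\#F_n^j-1\}$, $1\le j\le k$, satisfying (i) and (ii) whose sequence of $T$-castles refines, $\delta>0$ and $R>0$ such that for each $n>0$ and $j\in\{1,\dots,k\}$ the number of levels (spacers) between two consecutive copies of $T$-towers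 from the $n$-th $T$-castle in the $j$-th tower of the $(n+1)$-th $T$-castle is bounded by $R$, and $\inf_{n\ge0}\min_{1\le i\le k}\mu(W_n^i)>\delta$. Quasi-exact finite rank means quasi-exact rank at most $k$ for some $k$. **Partial rigidity**: there are $\delta>0$ and an increasing sequence of integers $(m_n)$ such that $\liminf_{n\to\infty}\mu(A\cap T_{m_n}A)\ge\delta\mu(A)$ for each $A\in\mathfrak B$. *)

(* Defs.v *)
From HB Require Import structures.
From mathcomp Require Import all_boot all_order all_algebra.
From mathcomp Require Import all_classical all_reals all_analysis.

Set Implicit Arguments.
Unset Strict Implicit.
Unset Printing Implicit Defensive.

Import Order.TTheory GRing.Theory Num.Theory.
Import numFieldNormedType.Exports.

Local Open Scope classical_set_scope.
Local Open Scope ring_scope.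
Local Open Scope ereal_scope.

(* [X] with its sigma-algebra is a standard Borel space: it is isomorphic to a
   Polish space [P] with its Borel sets (a Hausdorff pseudometric is a
   metric). *)
Definition standard_borel (R : realType) (d : measure_display)
    (X : measurableType d) : Prop :=
  exists (P : completePseudoMetricType R) (f : X -> P),
    [/\ hausdorff_space P,
        exists2 S : set P, countable S & dense S,
        bijective f &
        forall A : set X, measurable A <-> (<<s (@open P) >>) (f @` A)].

Definition non_atomic (R : realType) (d : measure_display)
    (X : measurableType d) (mu : set X -> \bar R) : Prop :=
  forall A : set X, measurable A -> 0 < mu A ->
    exists B : set X, [/\ measurable B, B `<=` A, 0 < mu B & mu B < mu A].

Section ZAction.
Variables (R : realType) (d : measure_display) (X : measurableType d).
Variables (mu : probability X R) (T : int -> X -> X).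

Definition pp_Zaction : Prop :=
  [/\ forall x, T 0%R x = x,
      forall (m n : int) x, T (m + n)%R x = T m (T n x),
      forall m, measurable_fun setT (T m) &
      forall m (A : set X), measurable A -> mu (T m @^-1` A) = mu A].

Definition ergodic : Prop :=
  forall A : set X, measurable A -> (forall m, T m @^-1` A = A) ->
    mu A = 0 \/ mu A = 1.

Definition partially_rigid : Prop :=
  exists (delta : R) (m : nat -> int),
    [/\ (0 < delta)%R, increasing_seq m &
        forall A : set X, measurable A ->
          delta%:E * mu A <= limn_einf (fun n => mu (A `&` T (m n) @` A))].

Section Castles.
Variable k : nat.

(* [B n j] is the base of the [j]-th tower of the [n]-th castle and [h n j] its
   height, so that F_n^j = {0, ..., h n j - 1}. *)
Variables (B : nat -> 'I_k -> set X) (h : nat -> 'I_k -> nat).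

Definition level (n : nat) (j : 'I_k) (g : nat) : set X := T g%:Z @` B n j.

Definition tower_union (n : nat) (j : 'I_k) : set X :=
  \bigcup_(g in `I_(h n j)) level n j g.

Definition levels_union (n : nat) (F : 'I_k -> set nat) : set X :=
  \bigcup_j \bigcup_(g in F j) level n j g.

Definition castle_index (n : nat) : set ('I_k -> set nat) :=
  [set F | forall j, F j `<=` `I_(h n j)].

Definition levels_disjoint : Prop :=
  forall n, trivIset [set p : 'I_k * nat | (p.2 < h n p.1)%N]
                     (fun p => level n p.1 p.2).

Definition levels_generate : Prop :=
  forall A : set X, measurable A ->
    (fun n => ereal_inf [set mu (A `+` levels_union n F) | F in castle_index n])
      @ \oo --> 0.

Definition rank_castles : Prop :=
  [/\ forall n j, measurable (B n j), levels_disjoint & levels_generate].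

(* The levels [a, a + h n i) of the [j]-th tower of the next castle form a copy
   of the [i]-th tower of the [n]-th castle. *)
Definition tower_copy (n : nat) (j i : 'I_k) (a : nat) : Prop :=
  (a + h n i <= h n.+1 j)%N /\
  forall g, (g < h n i)%N -> level n.+1 j (a + g) `<=` level n i g.

Definition spacer (n : nat) (j : 'I_k) (l : nat) : Prop :=
  forall i, level n.+1 j l `&` tower_union n i = set0.

(* The first clause alone would allow the ends of a tower of the next castle to
   cut through a tower of the [n]-th one (in the dyadic odometer, the two-level
   castle with base 2Z_2 followed by the four-level castle with base 1 + 4Z_2);
   the second clause says that the towers of the next castle are stacks of
   full copies and spacers. *)
Definition refining : Prop :=
  forall n,
    (forall i g, (g < h n i)%N ->
       exists2 F, castle_index n.+1 F & level n i g = levels_union n.+1 F) /\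
    (forall j l, (l < h n.+1 j)%N ->
       spacer n j l \/
       exists i a, tower_copy n j i a /\ (a <= l < a + h n i)%N).

(* A copy starting at [a] and the next copy, starting at [b], are separated by
   the [b - (a + h n i)] spacers [a + h n i, b). *)
Definition spacers_bounded (r : nat) : Prop :=
  forall n, (0 < n)%N -> forall (j i i' : 'I_k) (a b : nat),
    tower_copy n j i a -> tower_copy n j i' b -> (a + h n i <= b)%N ->
    (forall l, (a + h n i <= l < b)%N -> spacer n j l) ->
    (b - (a + h n i) <= r)%N.

End Castles.

Definition quasi_exact_rank_at_most (k : nat) : Prop :=
  exists (B : nat -> 'I_k -> set X) (h : nat -> 'I_k -> nat),
    [/\ rank_castles B h, refining B h &
        exists (delta : R) (r : nat),
          [/\ (0 < delta)%R, (0 < r)%N, spacers_bounded B h r &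
              delta%:E < ereal_inf (range (fun n =>
                           \big[Order.min/+oo]_(i < k) mu (tower_union B h n i)))]].

Definition quasi_exact_finite_rank : Prop :=
  exists2 k : nat, (0 < k)%N & quasi_exact_rank_at_most k.

End ZAction.

(* Main.v *)
(* It suffices to find a constant c > 0 and infinitely many stages n having a
   tower with base B of the n-th castle and a time m > 0 such that
   mu(B /\ T_m^-1 B) >= c mu(B). Indeed, such an m is at least the height of the
   tower, which tends to infinity since mu is non-atomic; all levels L of the
   tower satisfy mu(L /\ T_m L) >= c mu(L); and the union W of its levels is
   almost invariant with mu(W) > delta, hence, by ergodicity,
   mu(A /\ W) >= delta mu(A) - o(1) for every measurable A. Approximating A by
   unions of levels gives partial rigidity with constant c delta.

   Return times are found as follows. Let H(n) be the minimal height in the n-th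
   castle and i a shortest tower. Some tower j of the next castle carries a
   proportion 1/k of the measure of B_n^i. If it contains at least two copies of
   tower i, then tower i, being shortest, makes up a definite proportion of the
   copies stacked in tower j, so a definite proportion of them recur after a
   bounded number of copies; since the gaps are bounded, there are boundedly many
   possible return times, and one of them is frequent. If it contains at most one
   copy, then H(n+1) <= C H(n). If the latter holds for all large n, choose
   q_0 = n < q_1 < ... < q_k along which H grows by bounded factors larger than 2k.
   A shortest tower of stage q_t has height comparable to H(n); either it passes
   twice through the same level of stage n, which gives a return time, or some
   tower of stage n has height between H(q_t)/2k and H(q_t). The second case
   cannot occur for all t = 0, ..., k, as there are only k towers. *)

Require Import Defs.
From HB Require Import structures.
From mathcomp Require Import all_boot all_order all_algebra.
From mathcomp Require Import all_classical all_reals all_analysis.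
From mathcomp Require Import measurable_realfun ring lra zify.

Set Implicit Arguments.
Unset Strict Implicit.
Unset Printing Implicit Defensive.

Import Order.TTheory GRing.Theory Num.Theory.
Import numFieldNormedType.Exports.

(** * Recurrence in finite increasing sequences with few distinct steps *)

Lemma count_has_le (I J : Type) (P : I -> pred J) (D : seq I) (s : seq J) :
  count (fun a => has (P^~ a) D) s <= \sum_(d <- D) count (P d) s.
Proof.
elim: D => [|d D IH]; first by rewrite big_nil count_pred0.
rewrite big_cons (leq_trans _ (leq_add (leqnn _) IH))//.
by rewrite -count_predUI leq_addr.
Qed.

Section Recurrence.

(** The extra 0 admits sums of fewer than [L] elements of [E], so the lists grow with [L]. *)
Fixpoint step_sums (E : seq nat) (L : nat) : seq nat :=
  if L is L'.+1 then [seq x + y | x <- step_sums E L', y <- 0 :: E]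
  else [:: 0].

Lemma mem_step_sums E L x y : x \in step_sums E L -> y \in 0 :: E ->
  x + y \in step_sums E L.+1.
Proof. by move=> xL yE; apply/allpairsP; exists (x, y). Qed.

Lemma size_step_sums E L : size (step_sums E L) = (size E).+1 ^ L.
Proof.
by elim: L => // L IH; rewrite /step_sums -/step_sums size_allpairs IH expnSr.
Qed.

Lemma step_sums_widen E L L' x : L <= L' -> x \in step_sums E L ->
  x \in step_sums E L'.
Proof.
move=> /subnKC <-; elim: (L' - L) => [|m IH] xL; first by rewrite addn0.
by rewrite addnS -[x]addn0; apply: mem_step_sums => //; exact: IH.
Qed.

Variables (st E : seq nat).
Hypothesis sorted_st : sorted ltn st.
Hypothesis st_step : forall t, t.+1 < size st ->
  nth 0 st t.+1 - nth 0 st t \in E.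

Lemma st_mono t u : t < u -> u < size st -> nth 0 st t < nth 0 st u.
Proof.
move=> tu us.
by apply: (sorted_ltn_nth ltn_trans) => //; rewrite inE // (ltn_trans tu).
Qed.

Lemma st_diff t L : t + L < size st ->
  nth 0 st (t + L) - nth 0 st t \in step_sums E L.
Proof.
elim: L => [|L IH]; first by rewrite addn0 subnn inE.
rewrite addnS => tL.
have bc := st_mono (ltnSn (t + L)) tL.
have ab : nth 0 st t <= nth 0 st (t + L).
  case: (L) tL => [|L'] tL; first by rewrite addn0.
  by apply/ltnW/st_mono; lia.
have -> : nth 0 st (t + L).+1 - nth 0 st t =
    (nth 0 st (t + L) - nth 0 st t) + (nth 0 st (t + L).+1 - nth 0 st (t + L)) by lia.
by apply: mem_step_sums; [exact/IH/ltnW|rewrite inE st_step ?orbT].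
Qed.

Variables (Q : pred nat) (K : nat).
Hypotheses (K_gt0 : 0 < K) (few : size st <= K * count Q st)
  (twice : 1 < count Q st).

Let D := step_sums E (4 * K).
Let hit d a := [&& Q a, a + d \in st & Q (a + d)].
Let good a := has (fun d => (0 < d) && hit d a) D.

(* Two elements of [Q] whose ranks lie in the same block of length [4 K] differ
   by an element of [D]; hence each block contains at most one bad element. *)
Lemma count_bad : count (fun a => Q a && ~~ good a) st <= size st %/ (4 * K) + 1.
Proof.
rewrite -size_filter; set s := seq.filter _ _.
have us : uniq st by exact: (sorted_uniq ltn_trans ltnn sorted_st).
pose f a := index a st %/ (4 * K).
have sP a : a \in s -> [/\ Q a, ~~ good a & a \in st].
  by rewrite mem_filter => /andP[/andP[]].
have aux a b : a \in s -> b \in s -> index a st < index b st -> f a = f b -> False.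
  move=> /sP[Qa nga ast] /sP[Qb ngb bst] ab fab.
  have bs : index b st < size st by rewrite index_mem.
  pose L := index b st - index a st.
  have L4 : L <= 4 * K.
    have := divn_eq (index a st) (4 * K); have := divn_eq (index b st) (4 * K).
    have := ltn_pmod (index b st) (_ : 0 < 4 * K).
    rewrite -/(f a) -/(f b) fab /L; lia.
  have bE : index b st = index a st + L by rewrite /L; lia.
  have := @st_diff (index a st) L; rewrite -bE !nth_index// => /(_ bs) bD.
  have := st_mono ab bs; rewrite !nth_index// => altb.
  move/negP: nga; apply; apply/hasP; exists (b - a).
    exact: step_sums_widen bD.
  by rewrite subn_gt0 altb /hit subnKC ?Qa ?bst ?Qb// ltnW.
rewrite -(size_map f) -[leqRHS](size_iota 0); apply: uniq_leq_size.
  rewrite map_inj_in_uniq ?filter_uniq// => a b sa sb fab.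
  have [[_ _ ast] [_ _ bst]] := (sP a sa, sP b sb).
  case: (ltngtP (index a st) (index b st)) => [ab|ba|].
  - by case: (aux a b).
  - by case: (aux b a).
  - by move=> e; rewrite -(nth_index 0 ast) e nth_index.
move=> _ /mapP[a /sP[_ _ ast] ->]; rewrite mem_iota add0n /f addn1 ltnS.
by rewrite leq_div2r// ltnW// index_mem.
Qed.

(** By [few] and [count_bad], whose additive 1 is absorbed by [twice], at least a quarter of the
    elements of [Q] in [st] recur after a positive time in [D]. By pigeonhole over the
    [(size E).+1 ^ (4 * K)] members of [D], one time serves a fixed proportion of them. *)
Lemma frequent_return : exists2 d, 0 < d &
  count Q st <= 4 * (size E).+1 ^ (4 * K) *
    count (fun a => [&& Q a, a + d \in st & Q (a + d)]) st.
Proof.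
have goodE : count Q st <= 4 * count good st.
  have : count Q st <= count good st + count (fun a => Q a && ~~ good a) st.
    rewrite -count_predUI (leq_trans _ (leq_addr _ _))//; apply: sub_count => a /= ->.
    by case: (good a).
  have := count_bad; have := leq_divM (size st) (4 * K).
  move: few twice; nia.
rewrite -size_step_sums -/D.
have [/hasP[d dD /andP[d0 dP]]|/hasPn nd] := boolP (has (fun d => (0 < d) &&
    (count Q st <= 4 * size D * count (hit d) st)) D); first by exists d.
exfalso.
have {}nd d : d \in D ->
    4 * size D * count (fun a => (0 < d) && hit d a) st <= (count Q st).-1.
  move=> dD; have := nd d dD; rewrite negb_and; case: (posnP d) => [-> _|d0 /=].
    by rewrite count_pred0 muln0.
  by rewrite -ltnNge => ?; rewrite -ltnS prednK// (leq_ltn_trans _ twice).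
have := count_has_le (fun d a => (0 < d) && hit d a) D st.
have : \sum_(d <- D) 4 * size D * count (fun a => (0 < d) && hit d a) st <=
    \sum_(d <- D) (count Q st).-1.
  by rewrite big_seq [leqRHS]big_seq; apply: leq_sum.
rewrite big_const_seq count_predT iter_addn_0 -big_distrr /=.
have D0 : 0 < size D by rewrite size_step_sums expn_gt0.
rewrite -/(good _) => h1 h2.
have h3 : 4 * count good st <= (count Q st).-1.
  by rewrite -(leq_pmul2r D0) (leq_trans _ h1)// mulnAC leq_mul2l h2 orbT.
move: goodE h3 twice; lia.
Qed.

End Recurrence.

Local Open Scope classical_set_scope.
Local Open Scope ring_scope.

(** * Real-valued measures of sets *)

Section RealMeasure.
Context (R : realType) (d : measure_display) (X : measurableType d).
Variable mu : probability X R.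

Definition pr (A : set X) : R := fine (mu A).

Lemma prE A : measurable A -> mu A = (pr A)%:E.
Proof. by move=> mA; rewrite fineK// fin_num_measure. Qed.

Lemma pr_ge0 A : 0 <= pr A.
Proof. exact: fine_ge0. Qed.

Lemma le_pr A B : measurable A -> measurable B -> A `<=` B -> pr A <= pr B.
Proof.
move=> mA mB AB; rewrite -lee_fin -!prE//.
by apply: le_measure; rewrite ?inE.
Qed.

Lemma pr_le1 A : measurable A -> pr A <= 1.
Proof. by move=> mA; rewrite -lee_fin -prE//; exact: probability_le1. Qed.

Lemma pr0 : pr set0 = 0.
Proof. by rewrite /pr measure0. Qed.

Lemma prT : pr setT = 1.
Proof. by rewrite /pr probability_setT. Qed.

Lemma prU A B : measurable A -> measurable B -> A `&` B = set0 ->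
  pr (A `|` B) = pr A + pr B.
Proof.
move=> mA mB AB; apply: EFin_inj; rewrite EFinD -!prE//; last exact: measurableU.
exact: measureU.
Qed.

Lemma prDI A B : measurable A -> measurable B ->
  pr A = pr (A `\` B) + pr (A `&` B).
Proof.
move=> mA mB; rewrite -prU; first by rewrite setDE -setIUr setUCl setIT.
- exact: measurableD.
- exact: measurableI.
- by rewrite setDE setIACA setICl setI0.
Qed.

Lemma pr_le_cover A B C : measurable A -> measurable B -> measurable C ->
  A `<=` B `|` C -> pr A <= pr B + pr C.
Proof.
move=> mA mB mC ABC.
rewrite (prDI mA mC) lerD//.
  apply: le_pr => //; first exact: measurableD.
  by move=> x [/ABC[//|//]].
by apply: le_pr => //; first exact: measurableI.
Qed.

Lemma pr_le_sum (I : eqType) (s : seq I) (F : I -> set X) (A : set X) :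
    (forall i, measurable (F i)) -> measurable A ->
    (forall x, A x -> exists2 i, i \in s & F i x) ->
  pr A <= \sum_(i <- s) pr (F i).
Proof.
move=> mF; elim: s A => [|i s IH] A mA AF.
  rewrite big_nil (_ : A = set0) ?pr0//.
  by apply/seteqP; split => // x /AF[].
rewrite big_cons (le_trans (pr_le_cover mA (mF i) (measurableD mA (mF i)) _))//.
  by move=> x Ax; have [|] := pselect (F i x); [left|right].
rewrite lerD2l; apply: IH; first exact: measurableD.
move=> x [/AF[j]]; rewrite inE => /predU1P[-> //|js Fj nF].
by exists j.
Qed.

Lemma pr_bigcup_count (F : nat -> set X) (b : R) (h : nat) (P : pred nat) :
    (forall g, measurable (F g)) -> (forall g, pr (F g) = b) ->
    trivIset [set g | (g < h)%N && P g] F ->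
  measurable (\bigcup_(g in [set g | (g < h)%N && P g]) F g) /\
  pr (\bigcup_(g in [set g | (g < h)%N && P g]) F g) =
    (count P (iota 0 h))%:R * b.
Proof.
move=> mF bF; elim: h => [|h IH] tF.
  rewrite (_ : [set _ | _] = set0) ?bigcup_set0 ?pr0 ?mul0r//.
  by apply/seteqP; split.
have [|mU prh] := IH.
  apply: sub_trivIset tF => g /= /andP[gh ->].
  by rewrite ltnS ltnW.
rewrite -addn1 iotaD count_cat add0n /= addn0 natrD mulrDl -prh.
have [Ph|nPh] := boolP (P h); last first.
  rewrite mul0r addr0.
  suff -> : [set g | (g < h + 1)%N && P g] = [set g | (g < h)%N && P g] by [].
  apply/seteqP; split => g /= /andP[gh Pg]; apply/andP; split => //; last lia.
  by move: gh; rewrite addn1 ltnS leq_eqVlt => /predU1P[gh|//]; rewrite -gh Pg in nPh.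
have -> : [set g | (g < h + 1)%N && P g] = [set g | (g < h)%N && P g] `|` [set h].
  apply/seteqP; split => g /=.
    move=> /andP[]; rewrite addn1 ltnS leq_eqVlt => /predU1P[->|gh Pg]; first by right.
    by left; rewrite gh.
  by move=> [/andP[gh ->]|->]; rewrite ?Ph andbT; lia.
rewrite bigcup_setU bigcup_set1; split; first exact: measurableU.
rewrite prU// ?bF ?mul1r//.
apply/seteqP; split => // x [[g /= /andP[gh Pg] Fg] Fh].
have := tF g h; rewrite /= Pg Ph andbT => tgh.
suff gE : g = h by rewrite gE ltnn in gh.
by apply: tgh => //; [lia|lia|exists x].
Qed.

End RealMeasure.

(** * Images and preimages under the action *)

Section Action.
Context (R : realType) (d : measure_display) (X : measurableType d).
Variables (mu : probability X R) (T : int -> X -> X).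
Hypothesis hT : pp_Zaction mu T.

Lemma act0 x : T 0 x = x.
Proof. by case: hT. Qed.

Lemma actD m n x : T (m + n) x = T m (T n x).
Proof. by case: hT. Qed.

Lemma actK m : cancel (T m) (T (- m)).
Proof. by move=> x; rewrite -actD addNr act0. Qed.

Lemma actNK m : cancel (T (- m)) (T m).
Proof. by move=> x; rewrite -actD subrr act0. Qed.

Lemma image_act m A : T m @` A = T (- m) @^-1` A.
Proof.
apply/seteqP; split => x /=; first by move=> [y Ay <-]; rewrite actK.
by move=> Ax; exists (T (- m) x); rewrite ?actNK.
Qed.

Lemma measurable_act m : measurable_fun setT (T m).
Proof. by case: hT. Qed.

Lemma measurable_preimage_act m A : measurable A -> measurable (T m @^-1` A).
Proof. by move=> mA; rewrite -[_ @^-1` _]setTI; exact: measurable_act. Qed.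

Lemma measurable_image_act m A : measurable A -> measurable (T m @` A).
Proof. by rewrite image_act; exact: measurable_preimage_act. Qed.

Lemma pr_preimage_act m A : measurable A -> pr mu (T m @^-1` A) = pr mu A.
Proof. by case: hT => _ _ _ mup mA; rewrite /pr mup. Qed.

Lemma pr_image_act m A : measurable A -> pr mu (T m @` A) = pr mu A.
Proof. by rewrite image_act; exact: pr_preimage_act. Qed.

Lemma preimage_actD m n A : T (m + n) @^-1` A = T n @^-1` (T m @^-1` A).
Proof. by apply/seteqP; split => x /=; rewrite actD. Qed.

End Action.

(** * Bounded measurable functions and Borel-Cantelli *)

Section BoundedMeasurable.
Context (R : realType) (d : measure_display) (X : measurableType d).
Variable mu : probability X R.
Implicit Types f g : X -> R.

Definition bounded_mfun f :=
  measurable_fun setT f /\ exists M : R, forall x, `|f x| <= M.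

Lemma bounded_mfun_cst c : bounded_mfun (fun=> c).
Proof. by split => //; exists `|c|. Qed.

Lemma bounded_mfunD f g : bounded_mfun f -> bounded_mfun g ->
  bounded_mfun (fun x => f x + g x).
Proof.
move=> [mf [M fM]] [mg [N gN]]; split; first exact: measurable_funD.
by exists (M + N) => x; rewrite (le_trans (ler_normD _ _))// lerD.
Qed.

Lemma bounded_mfunM f g : bounded_mfun f -> bounded_mfun g ->
  bounded_mfun (fun x => f x * g x).
Proof.
move=> [mf [M fM]] [mg [N gN]]; split; first exact: measurable_funM.
by exists (M * N) => x; rewrite normrM ler_pM.
Qed.

Lemma bounded_mfunB f g : bounded_mfun f -> bounded_mfun g ->
  bounded_mfun (fun x => f x - g x).
Proof.
move=> bf bg.
have -> : (fun x => f x - g x) = (fun x => f x + (-1) * g x).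
  by apply/funext => x; rewrite mulN1r.
by apply: bounded_mfunD => //; apply: bounded_mfunM => //; exact: bounded_mfun_cst.
Qed.

Lemma bounded_mfun_norm f : bounded_mfun f -> bounded_mfun (fun x => `|f x|).
Proof.
move=> [mf [M fM]]; split; first exact: measurableT_comp.
by exists M => x; rewrite normr_id.
Qed.

Lemma bounded_mfun_indic A : measurable A -> bounded_mfun (\1_A : X -> R).
Proof.
move=> mA; split; first exact: measurable_indic.
by exists 1 => x; rewrite indicE; case: (x \in A); rewrite ?normr1 ?normr0.
Qed.

Lemma bounded_mfun_integrable D f : measurable D -> bounded_mfun f ->
  mu.-integrable D (EFin \o f).
Proof.
move=> mD [mf [M fM]]; apply: measurable_bounded_integrable => //.
- by rewrite (le_lt_trans (probability_le1 _ mD))// ltry.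
- exact: measurable_funTS.
- exists M; split; first exact: num_real.
  by move=> t Mt x _ /=; rewrite (le_trans (fM x))// ltW.
Qed.

Lemma Rintegral_indic D A : measurable D -> measurable A ->
  \int[mu]_(x in D) (\1_A x : R) = pr mu (A `&` D).
Proof. by move=> mD mA; rewrite /Rintegral integral_indic. Qed.

Lemma chebyshev_sq f (s : R) : bounded_mfun f -> 0 < s ->
  measurable [set x | s < `|f x|] /\
  s ^+ 2 * pr mu [set x | s < `|f x|] <= \int[mu]_x (f x * f x).
Proof.
move=> bf s0.
have mS : measurable [set x | s < `|f x|].
  rewrite -[X in measurable X]setTI; have [mf _] := bounded_mfun_norm bf.
  have := mf measurableT _ (measurable_itv `]s, +oo[).
  by rewrite set_itvoy.
split => //.
have := Rintegral_indic measurableT mS; rewrite setIT => <-.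
have bS := bounded_mfun_indic mS.
rewrite -RintegralZl//; last exact: bounded_mfun_integrable.
apply: le_Rintegral => //.
- apply: bounded_mfun_integrable => //.
  exact: (bounded_mfunM (bounded_mfun_cst _)).
- by apply: bounded_mfun_integrable => //; exact: bounded_mfunM.
- move=> x _; rewrite indicE; case: (boolP (x \in _)); last first.
    by rewrite mulr0 -expr2 sqr_ge0.
  rewrite inE /= mulr1 => sf; rewrite -expr2 -(real_normK (num_real (f x))).
  by rewrite ler_sqr ?nnegrE// ltW.
Qed.

(** Chebyshev bounds the measure of the set where [u m] exceeds 2^-m in absolute value by C 8^-m 4^m
    = C 2^-m, which is summable, so Borel-Cantelli applies. *)
Lemma ae_eventually_small (u : nat -> X -> R) (C : R) :
    (forall m, bounded_mfun (u m)) ->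
    (forall m, \int[mu]_x (u m x * u m x) <= C * 8^-1 ^+ m) ->
  {ae mu, forall x, exists N, forall m, (N <= m)%N -> `|u m x| <= 2^-1 ^+ m}.
Proof.
move=> bu uC; pose F m := [set x | 2^-1 ^+ m < `|u m x|].
have h0 m : (0 : R) < 2^-1 ^+ m by rewrite exprn_gt0// invr_gt0.
have mF m : measurable (F m) by case: (chebyshev_sq (bu m) (h0 m)).
have prF m : pr mu (F m) <= C * 2^-1 ^+ m.
  have [_ /le_trans/(_ (uC m))] := chebyshev_sq (bu m) (h0 m).
  have -> : (8^-1 : R) = 2^-1 ^+ 2 * 2^-1 by field.
  by rewrite exprMn exprAC mulrCA ler_pM2l// exprn_gt0.
have C0 : 0 <= C.
  by have := prF 0%N; rewrite expr0 mulr1; apply: le_trans; exact: pr_ge0.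
have FN : mu (lim_sup_set F) = 0%E.
  apply: lim_sup_set_cvg0 => //.
  have C20 : 0 <= C *+ 2 by rewrite mulrn_wge0.
  apply: le_lt_trans (ltry (C *+ 2)).
  apply: le_trans (epsilon_trick0 xpredT C20).
  apply: lee_nneseries => [m _ _|m _] //=; rewrite (prE mu (mF m)) lee_fin.
  rewrite (le_trans (prF m))//.
  by rewrite -[C *+ 2]mulr_natr natrX exprS invfM mulrA mulfK// exprVn.
exists (lim_sup_set F); split => //.
  by apply: bigcap_measurable => // n _; exact: bigcup_measurable.
move=> x /= xP n _; apply: contrapT => nF; apply: xP; exists n => m nm.
by rewrite leNgt; apply/negP => um; apply: nF; exists m.
Qed.

End BoundedMeasurable.

(** * Convex averages of translates of an indicator *)

Section OrbitAverages.
Context (R : realType) (d : measure_display) (X : measurableType d).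
Variables (mu : probability X R) (T : int -> X -> X).
Hypothesis hT : pp_Zaction mu T.

(* Midpoints generate enough of the convex hull of the translates of [\1_A] to
   minimize the L^2 norm by the parallelogram identity. *)
Inductive orbit_average (A : set X) : (X -> R) -> Prop :=
| orbit_average_indic (m : nat) : orbit_average A (fun x => \1_A (T m%:Z x))
| orbit_average_mid f g : orbit_average A f -> orbit_average A g ->
    orbit_average A (fun x => 2^-1 * (f x + g x)).

Lemma bounded_mfun_act f m :
  bounded_mfun f -> bounded_mfun (fun x => f (T m x) : R).
Proof.
move=> [mf [M fM]]; split; last by exists M.
exact: (measurableT_comp mf (measurable_act hT m)).
Qed.

Lemma Rintegral_act f m : bounded_mfun f ->
  \int[mu]_x (f (T m x) : R) = \int[mu]_x f x.
Proof.
move=> bf; congr fine; have [mf _] := bf.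
have := @integral_pushforward _ _ _ _ _ _ (measurable_act hT m) mu setT
  (EFin \o f).
rewrite preimage_setT => <-//.
- apply: eq_measure_integral => [|mTm A mA _]; first exact: measurable_act hT m.
  by have [_ _ _ mup] := hT; rewrite -[RHS](mup m A mA).
- exact/measurable_EFinP.
- exact: bounded_mfun_integrable (bounded_mfun_act m bf).
Qed.

Lemma bounded_orbit_average A f : measurable A -> orbit_average A f ->
  bounded_mfun f.
Proof.
move=> mA; elim=> [m|{}f g _ bf _ bg].
  exact: bounded_mfun_act (bounded_mfun_indic R mA).
exact: bounded_mfunM (bounded_mfun_cst _ _) (bounded_mfunD bf bg).
Qed.

Lemma orbit_average_itv A f : orbit_average A f -> forall x, 0 <= f x <= 1.
Proof.
elim=> [m x|{}f g _ bf _ bg x].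
  by rewrite indicE; case: (_ \in _); rewrite ?lexx ?ler01.
by have := bf x; have := bg x; lra.
Qed.

Lemma orbit_average_act A f : orbit_average A f ->
  orbit_average A (fun x => f (T 1 x)).
Proof.
elim=> [m|{}f g _ bf _ bg]; last exact: orbit_average_mid.
have -> : (fun x => \1_A (T m%:Z (T 1 x))) = (fun x => \1_A (T (m.+1)%:Z x) : R).
  by apply/funext => x; rewrite -(actD hT) -addn1.
exact: orbit_average_indic.
Qed.

(** A point of [W] that is outside [W] at time [m] exits at one of [m] steps, and by invariance each
    step costs the same measure. *)
Lemma pr_sub_preimage_act W (m : nat) : measurable W ->
  pr mu (W `\` T m%:Z @^-1` W) <= m%:R * pr mu (W `\` T 1 @^-1` W).
Proof.
move=> mW; have mp n := measurable_preimage_act hT n mW.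
elim: m => [|m IH].
  rewrite mul0r (_ : _ `\` _ = set0) ?pr0//.
  by apply/seteqP; split => // x [] /=; rewrite (act0 hT).
have mD n : measurable (W `\` T n @^-1` W) by exact: measurableD.
have mE := measurable_preimage_act hT m%:Z (mD 1).
have := pr_le_cover mu (mD m.+1%:Z) (mD m%:Z) mE.
rewrite (pr_preimage_act hT)// -natr1 mulrDl mul1r => le.
apply: le_trans (le _) _; last exact: lerD.
move=> x [Wx /= nW].
have [Wm|Wm] := pselect (W (T m%:Z x)); last by left.
by right; split => //=; rewrite -(actD hT) -intS.
Qed.

(** For the translate by [m], the part of T_m^-1 A in [W] exceeds T_m^-1 (A /\ W) only by points of
    [W] outside [W] at time [m], whence C = m; midpoints average the constants. *)
Lemma orbit_average_le A f : measurable A -> orbit_average A f ->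
  exists2 C : R, 0 <= C & forall W, measurable W ->
    \int[mu]_(x in W) f x <= pr mu (A `&` W) + C * pr mu (W `\` T 1 @^-1` W).
Proof.
move=> mA; elim=> [m|{}f g af [C C0 fC] ag [D D0 gD]].
  exists m%:R => // W mW.
  have mpA := measurable_preimage_act hT m%:Z mA.
  have mpW := measurable_preimage_act hT m%:Z mW.
  have := Rintegral_indic mu mW mpA.
  rewrite (_ : \int[mu]_(x in W) \1_(T m @^-1` A) x =
     \int[mu]_(x in W) (\1_A (T m x))); last first.
    by apply: eq_Rintegral => x _; rewrite !indicE; congr (_%:R); apply/idP/idP; rewrite !inE.
  move=> ->; apply: le_trans (lerD (lexx _) (pr_sub_preimage_act m mW)).
  rewrite -(pr_preimage_act hT m (measurableI _ _ mA mW)).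
  apply: pr_le_cover; [exact: measurableI| |exact: measurableD|].
    exact: (measurable_preimage_act hT m (measurableI _ _ mA mW)).
  move=> x [Ax Wx]; have [Wm|Wm] := pselect (W (T m%:Z x)); first by left.
  by right.
exists (2^-1 * (C + D)); first by lra.
move=> W mW; have bf := bounded_orbit_average mA af.
have bg := bounded_orbit_average mA ag.
rewrite RintegralZl//; last exact: bounded_mfun_integrable (bounded_mfunD bf bg).
rewrite RintegralD//; try exact: bounded_mfun_integrable.
by have := fC W mW; have := gD W mW; lra.
Qed.

End OrbitAverages.

(** * Mean ergodic theorem *)

Section MeanErgodic.
Context (R : realType) (d : measure_display) (X : measurableType d).
Variables (mu : probability X R) (T : int -> X -> X).
Hypotheses (hT : pp_Zaction mu T) (herg : ergodic mu T).

Lemma ae_of_pr0 (A : set X) : measurable A -> pr mu A = 0 ->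
  {ae mu, forall x, ~ A x}.
Proof.
move=> mA A0; exists A; split => //; first by rewrite prE// A0.
by move=> x /= /contrapT.
Qed.

(** [ergodic] concerns strictly invariant sets, so [S] is replaced by the set [E] of points whose
    whole orbit lies in [S]: it is strictly invariant and differs from [S] by a null set. *)
Lemma ergodic_mod0 (S : set X) : measurable S ->
  pr mu (S `\` T 1 @^-1` S) = 0 -> pr mu S = 0 \/ pr mu S = 1.
Proof.
move=> mS S0.
have mp m := measurable_preimage_act hT m mS.
have Spos (m : nat) : pr mu (S `\` T m%:Z @^-1` S) = 0.
  apply/eqP; rewrite eq_le pr_ge0 andbT.
  by rewrite (le_trans (pr_sub_preimage_act hT m mS))// S0 mulr0.
(* Pulling S /\ T_(-m)^-1 S back by [T m] gives S /\ T_m^-1 S, so negative times inherit the null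
   differences. *)
have Sneg (m : nat) : pr mu (S `\` T (- m%:Z) @^-1` S) = 0.
  have mI : measurable (S `&` T (- m%:Z) @^-1` S) by exact: measurableI.
  have := pr_preimage_act hT m%:Z mI.
  rewrite preimage_setI -(preimage_actD hT) addNr.
  rewrite (_ : T 0 @^-1` S = S); last first.
    by apply/seteqP; split => x /=; rewrite (act0 hT).
  have := prDI mu mS (mp m%:Z); rewrite Spos setIC.
  have := prDI mu mS (mp (- m%:Z)); lra.
pose E := \bigcap_(n in [set: nat]) (T n%:Z @^-1` S `&` T (- n%:Z) @^-1` S).
have mE : measurable E.
  by apply: bigcap_measurableType => n _; exact: measurableI.
have EP x : E x <-> forall m, S (T m x).
  split=> [Ex|Sx n _]; last by split; exact: Sx.
  by case=> n; have [] := Ex n I => // _; have [] := Ex n.+1 I; rewrite NegzE.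
have Einv m : T m @^-1` E = E.
  apply/seteqP; split => x /=; rewrite !EP => Sx n.
    by have := Sx (n - m); rewrite -(actD hT) subrK.
  by rewrite -(actD hT).
have ES : E `<=` S by move=> x /EP/(_ 0); rewrite (act0 hT).
have : pr mu (S `\` E) = 0.
  have : {ae mu, forall x (n : nat), ~ (S `\` T n%:Z @^-1` S) x /\
                                     ~ (S `\` T (- n%:Z) @^-1` S) x}.
    apply: ae_foralln => n.
    have := ae_of_pr0 (measurableD mS (mp n%:Z)) (Spos n).
    have := ae_of_pr0 (measurableD mS (mp (- n%:Z))) (Sneg n).
    by apply: filterS2 => x; split.
  move=> [N [mN N0 sN]]; rewrite /pr (subset_measure0 _ mN _ N0)//.
    exact: measurableD.
  move=> x [Sx nEx]; apply: sN => /= aS; apply: nEx => n _.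
  have [p q] := aS n; split; apply: contrapT => nS; [exact: p|exact: q].
rewrite (prDI mu mS mE) => ->; rewrite add0r setIidr// /pr.
by case: (herg mE Einv) => ->; [left|right].
Qed.

Lemma parallelogram f g : bounded_mfun f -> bounded_mfun g ->
  \int[mu]_x ((f x - g x) * (f x - g x)) =
  2 * \int[mu]_x (f x * f x) + 2 * \int[mu]_x (g x * g x)
  - 4 * \int[mu]_x ((2^-1 * (f x + g x)) * (2^-1 * (f x + g x)) : R).
Proof.
move=> bf bg.
have bs : bounded_mfun (fun x => 2^-1 * (f x + g x)).
  exact: bounded_mfunM (bounded_mfun_cst _ _) (bounded_mfunD bf bg).
have bss := bounded_mfunM bs bs.
have bff := bounded_mfunM bf bf.
have bgg := bounded_mfunM bg bg.
have c2 u : bounded_mfun u -> bounded_mfun (fun x => 2 * u x : R).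
  by move=> bu; exact: bounded_mfunM (bounded_mfun_cst _ _) bu.
have c4 u : bounded_mfun u -> bounded_mfun (fun x => 4 * u x : R).
  by move=> bu; exact: bounded_mfunM (bounded_mfun_cst _ _) bu.
rewrite -!RintegralZl//; try exact: bounded_mfun_integrable.
rewrite -RintegralD//; [|by apply: bounded_mfun_integrable => //; exact: c2..].
rewrite -RintegralB//.
- by apply: eq_Rintegral => x _; field.
- by apply: bounded_mfun_integrable => //; apply: bounded_mfunD; exact: c2.
- by apply: bounded_mfun_integrable => //; exact: c4.
Qed.

Lemma Rintegral_orbit_average A f : measurable A -> orbit_average T A f ->
  \int[mu]_x f x = pr mu A.
Proof.
move=> mA; elim=> [m|{}f g af If ag Ig].
  rewrite (Rintegral_act hT m (bounded_mfun_indic R mA)).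
  by rewrite Rintegral_indic// setIT.
have bf := bounded_orbit_average hT mA af.
have bg := bounded_orbit_average hT mA ag.
rewrite RintegralZl//; last exact: bounded_mfun_integrable (bounded_mfunD bf bg).
rewrite RintegralD//; try exact: bounded_mfun_integrable.
by rewrite If Ig; field.
Qed.

(** Two averages whose squared L^2 norms are within e of the infimum are at squared distance at most
    4 e, since their midpoint is again an average. This applies to [f m] and [f m.+1], and to [f m]
    and its translate by [T 1], which has the same norm. The rate 8^-m is the one used in
    [ae_eventually_small]. *)
Lemma minimizing_orbit_averages A : measurable A ->
  exists f : nat -> X -> R, [/\ forall m, orbit_average T A (f m),
    forall m, \int[mu]_x ((f m.+1 x - f m x) * (f m.+1 x - f m x))
      <= 4 * 8^-1 ^+ m &
    forall m, \int[mu]_x ((f m (T 1 x) - f m x) * (f m (T 1 x) - f m x))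
      <= 4 * 8^-1 ^+ m].
Proof.
move=> mA; pose E := [set r : R | exists2 f, orbit_average T A f &
  r = \int[mu]_x (f x * f x)].
have infE : has_inf E.
  split; first by exists (\int[mu]_x (\1_A (T 0%N%:Z x) * \1_A (T 0%N%:Z x)));
    eexists; last reflexivity; exact: orbit_average_indic.
  exists 0 => _ [f _ ->]; apply: Rintegral_ge0 => x _.
  by rewrite -expr2 sqr_ge0.
have /choice[f fP] : forall m : nat, exists f, orbit_average T A f /\
    \int[mu]_x (f x * f x) < inf E + 8^-1 ^+ m.
  move=> m; have [|_ [f af ->] lt] := @inf_adherent _ E (8^-1 ^+ m) _ infE.
    by rewrite exprn_gt0.
  by exists f.
have close (u v : X -> R) (e : R) : orbit_average T A u -> orbit_average T A v ->
    \int[mu]_x (u x * u x) <= inf E + e -> \int[mu]_x (v x * v x) <= inf E + e ->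
    \int[mu]_x ((u x - v x) * (u x - v x)) <= 4 * e.
  move=> au av ue ve.
  rewrite parallelogram; [|exact: (bounded_orbit_average hT mA)..].
  have : inf E <= \int[mu]_x ((2^-1 * (u x + v x)) * (2^-1 * (u x + v x)) : R).
    apply: ge_inf; first by case: infE.
    by eexists; last reflexivity; exact: orbit_average_mid.
  by lra.
exists f; split => m; first by case: (fP m).
- have [am lem] := fP m; have [an len] := fP m.+1.
  apply: close => //; last exact: ltW.
  rewrite (le_trans (ltW len))// lerD2l exprS ler_piMl ?exprn_ge0//; lra.
- have [am lem] := fP m; apply: close => //; last exact: ltW.
    exact: (orbit_average_act hT).
  have bm := bounded_orbit_average hT mA am.
  by rewrite (Rintegral_act hT 1 (bounded_mfunM bm bm)) ltW.
Qed.

Lemma cvg_half_expn (N : nat) : (fun m => 2 * 2^-1 ^+ (m + N)) @ \oo --> (0 : R).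
Proof.
have /= h : geometric (2 : R) 2^-1 @ \oo --> (0 : R).
  by apply: cvg_geometric; rewrite ger0_norm; lra.
by have := h; rewrite -(cvg_shiftn N).
Qed.

(* [u m - 2 * 2^-1 ^+ m] is eventually nondecreasing. *)
Lemma is_cvg_geometric_diff (u : nat -> R) (M : R) (N : nat) :
    (forall m, u m <= M) ->
    (forall m, (N <= m)%N -> `|u m.+1 - u m| <= 2^-1 ^+ m) ->
  cvgn u.
Proof.
move=> uM uN; pose v m := u (m + N)%N - 2 * 2^-1 ^+ (m + N).
have /cvg_ex[/= l vl] : cvgn v.
  apply: nondecreasing_is_cvgn.
    apply/nondecreasing_seqP => m; rewrite /v addSn exprS.
    have := uN (m + N)%N (leq_addl _ _); rewrite ler_norml => /andP[].
    by lra.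
  exists M => _ [m _ <-]; rewrite /v (le_trans _ (uM (m + N)%N))//.
  by rewrite lerBlDr lerDl mulr_ge0// exprn_ge0// invr_ge0.
apply: (cvgP l); rewrite -(cvg_shiftn N).
have -> : [sequence u (n + N)%N]_n = (fun m => v m + 2 * 2^-1 ^+ (m + N)).
  by apply/funext => m; rewrite /v subrK.
by rewrite -[l]addr0; apply: cvgD => //; exact: cvg_half_expn.
Qed.

(* A sequence minimizing the L^2 norm converges almost everywhere to an invariant
   function, which ergodicity forces to be the constant [pr mu A]. *)
Lemma mean_ergodic A (e : R) : measurable A -> 0 < e ->
  exists2 f, orbit_average T A f & \int[mu]_x `|f x - pr mu A| <= e.
Proof.
move=> mA e0; have [f [af fS fT]] := minimizing_orbit_averages mA.
have bf m := bounded_orbit_average hT mA (af m).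
have bfT m := bounded_orbit_average hT mA (orbit_average_act hT (af m)).
have mf m : measurable_fun setT (f m) by case: (bf m).
have f01 m x := orbit_average_itv (af m) x.
have aeS := ae_eventually_small (fun m => bounded_mfunB (bf m.+1) (bf m)) fS.
have aeT := ae_eventually_small (fun m => bounded_mfunB (bfT m) (bf m)) fT.
(* The upper limit is measurable on all of [X], while [f m x] converges only for almost every
   [x]. *)
pose h x : R := fine (limn_esup (fun m => (f m x)%:E)).
have mh : measurable_fun setT h.
  apply: measurableT_comp => //; apply: measurable_fun_limn_esup => m.
  exact/measurable_EFinP.
have hE x l : f ^~ x @ \oo --> l -> h x = l.
  move=> fl; rewrite /h.
  have fl' : (fun m => (f m x)%:E) @ \oo --> l%:E by apply: cvg_EFin => //; exact: nearW.
  by rewrite is_cvg_limn_esupE ?(cvg_lim _ fl')//; exact: cvgP fl'.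
have fh : {ae mu, forall x, f ^~ x @ \oo --> h x}.
  apply: filterS aeS => x [N xN].
  have /cvg_ex[/= l fl] : cvgn (f ^~ x).
    by apply: (@is_cvg_geometric_diff (f ^~ x) 1 N) => // m; case/andP: (f01 m x).
  by rewrite (hE x l).
have hT1 : {ae mu, forall x, h (T 1 x) = h x}.
  apply: filterS2 aeT fh => x [N xN] fx; apply: hE.
  have -> : (fun m => f m (T 1 x)) = (fun m => (f m (T 1 x) - f m x) + f m x).
    by apply/funext => m; rewrite subrK.
  rewrite -[h x]add0r; apply: cvgD => //; apply/cvgr0Pnorm_le => r r0.
  have := cvg_half_expn 0; move=> /cvgr0Pnorm_lt/(_ r r0).
  have := nbhs_infty_ge N; apply: filterS2 => m Nm mr.
  rewrite (le_trans (xN m Nm))// (le_trans _ (ltW mr))// addn0.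
  by rewrite ger0_norm ?mulr_ge0 ?exprn_ge0// ler_peMl ?exprn_ge0// ler1n.
(* Ergodicity makes [S] null or conull, so [h - a] has a constant sign almost everywhere; its
   integral is 0, hence so is that of its absolute value. *)
pose a := pr mu A; pose S := [set x | a < h x].
have mS : measurable S.
  rewrite -[S]setTI; have := mh measurableT _ (measurable_itv `]a, +oo[).
  by rewrite set_itvoy.
have S01 : pr mu S = 0 \/ pr mu S = 1.
  apply: ergodic_mod0 => //; move: hT1 => [N [mN N0 sN]].
  rewrite /pr (subset_measure0 _ mN _ N0)//.
    by apply: measurableD => //; exact: (measurable_preimage_act hT).
  by move=> x [Sx nSx]; apply: sN => /= hx; apply: nSx; rewrite /S /= hx.
have [ih fh0 fhI] : [/\ mu.-integrable setT (EFin \o h),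
  [sequence (\int[mu]_(x in setT) `|(f n x)%:E - (h x)%:E|)%E]_n @ \oo --> 0%E &
  [sequence (\int[mu]_(x in setT) (f n x)%:E)%E]_n @ \oo --> (\int[mu]_x (h x)%:E)%E].
  apply: (@dominated_convergence _ X R mu setT measurableT
    (fun n x => (f n x)%:E) (EFin \o h) (cst 1%E)) => //.
  - by move=> n; exact/measurable_EFinP.
  - exact/measurable_EFinP.
  - apply: filterS fh => x fx _; apply: cvg_EFin => //; exact: nearW.
  - have := bounded_mfun_integrable mu measurableT (bounded_mfun_cst X (1 : R)).
    exact.
  - apply: aeW => x n _; rewrite /= lee_fin ger0_norm; by case/andP: (f01 n x).
have EFinI (u : X -> R) : mu.-integrable setT (EFin \o u) ->
    (\int[mu]_x (u x)%:E)%E = (\int[mu]_x u x)%:E.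
  by move=> iu; rewrite /Rintegral fineK//; exact: integrable_fin_num.
have ihn m : mu.-integrable setT (EFin \o f m) by exact: bounded_mfun_integrable.
have inth : \int[mu]_x h x = a.
  apply: EFin_inj; rewrite -EFinI// -(cvg_lim (@ereal_hausdorff R) fhI).
  apply: (cvg_lim (@ereal_hausdorff R)); apply: cvg_near_cst; apply: nearW => m.
  by rewrite /= EFinI// (Rintegral_orbit_average mA (af m)).
have ia : mu.-integrable setT (EFin \o (fun=> a)).
  exact: bounded_mfun_integrable (bounded_mfun_cst X a).
have iB u v : mu.-integrable setT (EFin \o u) -> mu.-integrable setT (EFin \o v) ->
    mu.-integrable setT (EFin \o (fun x => u x - v x : R)).
  move=> iu iv; exact: (@integrableB _ _ _ mu setT measurableT _ _ iu iv).
have iN u : mu.-integrable setT (EFin \o u) ->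
    mu.-integrable setT (EFin \o (fun x => `|u x| : R)).
  by move=> iu; exact: (@integrable_norm _ _ _ mu setT _ iu).
have ha0 : \int[mu]_x `|h x - a| = 0.
  have h0 : \int[mu]_x (h x - a) = 0.
    by rewrite RintegralB// inth Rintegral_cst// -[fine _]/(pr mu setT) prT mulr1 subrr.
  have aeE (s : R) : {ae mu, forall x, `|h x - a| = s * (h x - a)} ->
      \int[mu]_x `|h x - a| = 0.
    move=> hs; transitivity (\int[mu]_x (s * (h x - a))); last first.
      by rewrite RintegralZl// ?h0 ?mulr0//; exact: iB.
    rewrite /Rintegral; congr fine; apply: ae_eq_integral => //.
    + apply/measurable_EFinP; apply: measurableT_comp => //.
      exact: measurable_funB.
    + apply/measurable_EFinP; apply: measurable_funM => //.
      exact: measurable_funB.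
    + by apply: filterS hs => x hx _; rewrite hx.
  case: S01 => S01.
    apply: (aeE (- 1)); apply: filterS (ae_of_pr0 mS S01) => x /= /negP.
    by rewrite -leNgt => ha; rewrite mulN1r ler0_norm// subr_le0.
  apply: (aeE 1); have S0 : pr mu (~` S) = 0.
    have := prDI mu measurableT mS; rewrite prT setTI S01 setTD; lra.
  apply: filterS (ae_of_pr0 (measurableC mS) S0) => x /= /contrapT ha.
  by rewrite mul1r ger0_norm// subr_ge0 ltW.
have /fine_cvgP[_ /cvgr0Pnorm_le/(_ e e0)[N _ Ne]] := fh0.
exists (f N) => //; have /= := Ne N (leqnn N).
have -> : (\int[mu]_x `|(f N x)%:E - (h x)%:E|)%E = (\int[mu]_x `|f N x - h x|)%:E.
  by rewrite -EFinI//; apply: iN; exact: iB.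
rewrite ger0_norm /=; last by apply: Rintegral_ge0.
apply: le_trans; rewrite -[leRHS]addr0 -ha0 -RintegralD//; [|by apply: iN; exact: iB..].
apply: le_Rintegral => //; first by apply: iN; exact: iB.
  have iD u v : mu.-integrable setT (EFin \o u) -> mu.-integrable setT (EFin \o v) ->
      mu.-integrable setT (EFin \o (fun x => u x + v x : R)).
    by move=> iu iv; exact: (@integrableD _ _ _ mu setT measurableT _ _ iu iv).
  by apply: iD; apply: iN; exact: iB.
by move=> x _; rewrite (le_trans _ (ler_normD _ _))// addrA subrK.
Qed.

(** An orbit average L^1-close to the constant [pr mu A] has integral over [W] close to the product,
    and [orbit_average_le] bounds that integral. [C] is chosen before [W], so the last term is
    negligible when [W] is a tower with small boundary. *)
Lemma almost_invariant_independent A (e : R) : measurable A -> 0 < e ->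
  exists2 C : R, 0 <= C & forall W, measurable W ->
    pr mu A * pr mu W <= pr mu (A `&` W) + e + C * pr mu (W `\` T 1 @^-1` W).
Proof.
move=> mA e0; have [f af fe] := mean_ergodic mA e0.
have [C C0 fC] := orbit_average_le hT mA af.
exists C => // W mW; have bf := bounded_orbit_average hT mA af.
have bc := bounded_mfun_cst X (pr mu A).
have bB := bounded_mfunB bf bc.
have : \int[mu]_(x in W) (f x - pr mu A) = \int[mu]_(x in W) f x - pr mu A * pr mu W.
  by rewrite RintegralB ?Rintegral_cst//; exact: bounded_mfun_integrable.
have : `|\int[mu]_(x in W) (f x - pr mu A)| <= e.
  apply: le_trans (le_normr_Rintegral mW _) _; first exact: bounded_mfun_integrable.
  apply: le_trans _ fe; rewrite Rintegral_mkcond.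
  apply: le_Rintegral => //.
  - rewrite -restrict_EFin.
    apply/(integrable_mkcond (EFin \o (fun x => `|f x - pr mu A|)) mW).
    exact: bounded_mfun_integrable (bounded_mfun_norm bB).
  - exact: bounded_mfun_integrable (bounded_mfun_norm bB).
  - by move=> x _; rewrite patchE; case: ifP => // _; exact: normr_ge0.
have := fC W mW; rewrite ler_norml => fW /andP[+ _]; lra.
Qed.

End MeanErgodic.

(** * Towers, levels and refinement *)

Section Castles.
Context (R : realType) (d : measure_display) (X : measurableType d).
Variables (mu : probability X R) (T : int -> X -> X).
Hypothesis hT : pp_Zaction mu T.
Variables (k : nat) (B : nat -> 'I_k -> set X) (h : nat -> 'I_k -> nat).
Hypotheses (mB : forall n j, measurable (B n j))
  (hdisj : levels_disjoint T B h) (hgen : levels_generate mu T B h)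
  (href : refining T B h).
Variable delta : R.
Hypotheses (delta_gt0 : 0 < delta)
  (hdelta : forall n j, delta < pr mu (tower_union T B h n j)).

Lemma measurable_level n j g : measurable (level T B n j g).
Proof. exact: (measurable_image_act hT). Qed.

Lemma pr_level n j g : pr mu (level T B n j g) = pr mu (B n j).
Proof. exact: (pr_image_act hT). Qed.

Lemma levelE n j g x : level T B n j g x <-> B n j (T (- g%:Z) x).
Proof. by rewrite /level (image_act hT). Qed.

Lemma level_addE n j g m x : level T B n j (g + m) x <-> level T B n j g (T (- m%:Z) x).
Proof. by rewrite !levelE -(actD hT) PoszD opprD. Qed.

Lemma level0 n j : level T B n j 0 = B n j.
Proof. by apply/seteqP; split => x; rewrite levelE oppr0 (act0 hT). Qed.

Lemma level_inj n j j' g g' x : (g < h n j)%N -> (g' < h n j')%N ->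
  level T B n j g x -> level T B n j' g' x -> j = j' /\ g = g'.
Proof.
move=> gh gh' xl xl'.
by have [] := @hdisj n (j, g) (j', g') gh gh' (ex_intro _ x (conj xl xl')).
Qed.

Lemma measurable_levels_union n F : measurable (levels_union T B n F).
Proof.
apply: fin_bigcup_measurable => [|j _]; first exact: finite_finset.
by apply: bigcup_measurable => g _; exact: measurable_level.
Qed.

Lemma tower_unionE n j : tower_union T B h n j =
  \bigcup_(g in [set g | (g < h n j)%N && xpredT g]) level T B n j g.
Proof. by congr (\bigcup_(_ in _) _); apply/seteqP; split=> g /=; rewrite andbT. Qed.

Lemma levels_trivIset n j (P : pred nat) :
  trivIset [set g | (g < h n j)%N && P g] (level T B n j).
Proof.
move=> g g' /= /andP[gh _] /andP[gh' _] [x [xg xg']].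
by have [] := level_inj gh gh' xg xg'.
Qed.

Lemma measurable_tower_union n j : measurable (tower_union T B h n j).
Proof. by apply: bigcup_measurable => g _; exact: measurable_level. Qed.

Lemma pr_tower_union n j : pr mu (tower_union T B h n j) = (h n j)%:R * pr mu (B n j).
Proof.
rewrite tower_unionE; have [_ ->] := pr_bigcup_count (measurable_level n j)
  (pr_level n j) (@levels_trivIset n j xpredT).
by rewrite count_predT size_iota.
Qed.

Lemma height_base_gt n j : delta < (h n j)%:R * pr mu (B n j).
Proof. by rewrite -pr_tower_union. Qed.

Lemma height_base_le n j : (h n j)%:R * pr mu (B n j) <= 1.
Proof. by rewrite -pr_tower_union; exact/pr_le1/measurable_tower_union. Qed.

Lemma height_gt0 n j : (0 < h n j)%N.
Proof.
rewrite lt0n; apply/eqP => h0; have := height_base_gt n j.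
by rewrite h0 mul0r; have := delta_gt0; lra.
Qed.

Lemma base_gt0 n j : 0 < pr mu (B n j).
Proof.
rewrite lt_neqAle pr_ge0 andbT eq_sym; apply/eqP => b0.
by have := height_base_gt n j; rewrite b0 mulr0; have := delta_gt0; lra.
Qed.

Lemma base_nonempty n j : exists x, B n j x.
Proof.
apply: contrapT => nx; have := base_gt0 n j.
rewrite (_ : B n j = set0) ?pr0 ?ltxx//.
by apply/seteqP; split => // x Bx; apply: nx; exists x.
Qed.

Lemma level_nonempty n j g : exists x, level T B n j g x.
Proof. by have [x Bx] := base_nonempty n j; exists (T g%:Z x); exists x. Qed.

Lemma level_union1 n i g :
  level T B n i g = levels_union T B n (fun j => [set l | j = i /\ l = g]).
Proof.
apply/seteqP; split => [x xl|x [j _ [l [-> ->]]]//].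
by exists i => //; exists g.
Qed.

Lemma level_refines n q i g : (n <= q)%N -> (g < h n i)%N ->
  exists2 F, castle_index h q F & level T B n i g = levels_union T B q F.
Proof.
move=> + gh; elim: q => [|q IH].
  rewrite leqn0 => /eqP n0; rewrite n0 in gh *.
  by exists (fun j => [set l | j = i /\ l = g]); rewrite ?level_union1// => j _ [-> ->].
rewrite leq_eqVlt => /predU1P[nq|nq].
  rewrite nq in gh *.
  by exists (fun j => [set l | j = i /\ l = g]); rewrite ?level_union1// => j _ [-> ->].
have [F Fh ->] := IH nq.
exists (fun j => [set l | (l < h q.+1 j)%N /\ exists j' l', F j' l' /\
   level T B q.+1 j l `<=` level T B q j' l']); first by move=> j l [].
apply/seteqP; split => x; last first.
  by move=> [j _ [l [_ [j' [l' [Fl sub]]]] /sub xl]]; exists j' => //; exists l'.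
move=> [j' _ [l' Fl' xl']].
have [G Gh E] := (href q).1 j' l' (Fh _ _ Fl').
have := xl'; rewrite E => -[j _ [l Gl xl]].
exists j => //; exists l => //; split; first exact: Gh.
exists j', l'; split => //; rewrite E => y yl.
by exists j => //; exists l.
Qed.

Lemma level_sub n q i j g l x : (n <= q)%N -> (g < h n i)%N -> (l < h q j)%N ->
    level T B n i g x -> level T B q j l x ->
  level T B q j l `<=` level T B n i g.
Proof.
move=> nq gh lh xg xl.
have [F Fh E] := level_refines nq gh.
have := xg; rewrite E => -[j' _ [l' Fl' xl']].
have [-> ->] := level_inj lh (Fh _ _ Fl') xl xl'.
by move=> y yl; exists j' => //; exists l'.
Qed.

Lemma level_covered n q i g x : (n <= q)%N -> (g < h n i)%N ->
  level T B n i g x -> exists j l, (l < h q j)%N /\ level T B q j l x.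
Proof.
move=> nq gh; have [F Fh ->] := level_refines nq gh.
by move=> [j _ [l Fl xl]]; exists j, l; split => //; exact: Fh.
Qed.

(** By the second clause of [refining], a level that is not a spacer lies in a full copy of a tower
    of the previous castle. Descending from [q] to [n] through such copies never increases the
    height. *)
Lemma height_le n q i j g l x : (n <= q)%N -> (g < h n i)%N -> (l < h q j)%N ->
    level T B n i g x -> level T B q j l x ->
  (h n i <= h q j)%N.
Proof.
move=> + gh + xg; elim: q j l => [|q IH] j l.
  rewrite leqn0 => /eqP n0 lh xl; rewrite n0 in gh xg *.
  by have [->] := level_inj gh lh xg xl.
rewrite leq_eqVlt => /predU1P[nq|nq] lh xl.
  by rewrite nq in gh xg *; have [->] := level_inj gh lh xg xl.
rewrite ltnS in nq; have [j' [l' [lh' xl']]] := level_covered nq gh xg.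
have [sp|[j2 [a [[ah acop] al]]]] := (href q).2 j l lh.
  have : (level T B q.+1 j l `&` tower_union T B h q j') x by split => //; exists l'.
  by rewrite sp.
apply: leq_trans (leq_trans (leq_addl _ _) ah).
have xj2 : level T B q j2 (l - a) x.
  by apply: acop; [lia|rewrite subnKC//; lia].
by apply: (IH j2 (l - a)%N nq) => //; lia.
Qed.

Lemma levels_approx A (e : R) : measurable A -> 0 < e ->
  exists N, forall n, (N <= n)%N -> exists2 F, castle_index h n F &
    pr mu (A `+` levels_union T B n F) < e.
Proof.
move=> mA e0; have /fine_cvgP[[N1 _ N1P] /cvgr0Pnorm_lt/(_ e e0)[N2 _ N2P]] := hgen mA.
exists (maxn N1 N2) => n; rewrite geq_max => /andP[n1 n2].
have := N2P n n2 => /= /(le_lt_trans (ler_norm _)).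
rewrite -lte_fin fineK; last exact: N1P.
move=> /ereal_inf_lt[_ [F Fh <-]]; rewrite prE ?lte_fin; first by exists F.
by apply: measurableU; apply: measurableD => //; exact: measurable_levels_union.
Qed.

(** The levels of a late castle miss a set of measure less than [delta], whereas every tower of
    every castle has measure above [delta]; hence [N] is uniform in [q] and [j]. *)
Lemma tower_meets : exists N, forall n, (N <= n)%N -> forall q j, exists l i g x,
  [/\ (l < h q j)%N, (g < h n i)%N, level T B q j l x & level T B n i g x].
Proof.
have [N NP] := levels_approx measurableT delta_gt0; exists N => n /NP[F Fh Fd] q j.
apply: contrapT => nex; have := hdelta q j.
rewrite ltNge => /negP; apply; apply: le_trans (ltW Fd).
have mF := measurable_levels_union n F.
apply: le_pr; first exact: measurable_tower_union.
  by apply: measurableU; apply: measurableD.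
move=> x [l lh xl]; left; split => // -[i _ [g Fg xg]]; apply: nex.
by exists l, i, g, x; split => //; exact: Fh.
Qed.

Lemma height_mono : exists N, forall n q, (N <= n)%N -> (n <= q)%N ->
  forall j, exists i, (h n i <= h q j)%N.
Proof.
have [N NP] := tower_meets; exists N => n q Nn nq j.
have [l [i [g [x [lh gh xl xg]]]]] := NP n Nn q j.
by exists i; exact: (height_le nq gh lh xg xl).
Qed.

(** * Minimal heights tend to infinity *)

Hypothesis k_gt0 : (0 < k)%N.

Definition shortest n : 'I_k := [arg min_(i < Ordinal k_gt0) h n i].

Definition min_height n := h n (shortest n).

Lemma min_height_le n i : (min_height n <= h n i)%N.
Proof. by rewrite /min_height /shortest; case: arg_minnP => // j _; exact. Qed.

Lemma min_height_gt0 n : (0 < min_height n)%N.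
Proof. exact: height_gt0. Qed.

Lemma min_height_mono : exists N, forall n q, (N <= n)%N -> (n <= q)%N ->
  (min_height n <= min_height q)%N.
Proof.
have [N NP] := height_mono; exists N => n q Nn nq.
by have [i] := NP n q Nn nq (shortest q); exact/leq_trans/min_height_le.
Qed.

Hypothesis hna : non_atomic mu.

Lemma small_subset A (e : R) : measurable A -> 0 < pr mu A -> 0 < e ->
  exists A', [/\ measurable A', A' `<=` A, 0 < pr mu A' & pr mu A' < e].
Proof.
move=> mA A0 e0.
have halve m : exists A', [/\ measurable A', A' `<=` A, 0 < pr mu A' &
    pr mu A' <= 2^-1 ^+ m].
  elim: m => [|m [C [mC CA C0 Cm]]].
    by exists A; split => //; rewrite expr0 pr_le1.
  have [|D [mD DC]] := hna mC; first by rewrite prE.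
  rewrite !prE// !lte_fin => D0 DltC.
  have mCD := measurableD mC mD.
  have := prDI mu mC mD; rewrite (setIidr DC) exprS => CE.
  have [Dh|Dh] := leP (pr mu D) (pr mu C / 2).
    by exists D; split => //; [exact: subset_trans CA|lra].
  exists (C `\` D); split => //; [|lra|lra].
  by move=> x [/CA].
have /cvgr0Pnorm_lt/(_ e e0)[N _ /(_ N (leqnn N))] : geometric (1 : R) 2^-1 @ \oo --> (0 : R).
  by apply: cvg_geometric; rewrite ger0_norm; lra.
rewrite /= mul1r => /(le_lt_trans (ler_norm _)) Ne.
have [A' [? ? ? A'N]] := halve N; exists A'; split => //.
exact: le_lt_trans Ne.
Qed.

(* If the minimal heights were eventually constant, equal to [H], then the
   bases of height [H] would decrease to a set [Z] of positive measure; a subset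
   of [Z] of measure less than [delta / H] is not approximated by levels, as
   each level meeting [Z] has measure more than [delta / H]. *)
Lemma min_height_unbounded H : exists N, forall n, (N <= n)%N -> (H <= min_height n)%N.
Proof.
elim: H => [|H [N1 N1P]]; first by exists 0%N.
have [N2 N2P] := min_height_mono; have [N3 N3P] := tower_meets.
pose N := maxn N1 (maxn N2 N3).
apply: contrapT => nH.
have hH n : (N <= n)%N -> min_height n = H.
  move=> Nn; apply/eqP; rewrite eqn_leq N1P ?andbT; last by rewrite /N in Nn; lia.
  rewrite leqNgt; apply/negP => Hn; apply: nH; exists n => q nq.
  by rewrite (leq_trans Hn)// N2P//; rewrite /N in Nn; lia.
have H0 : (0 < H)%N by rewrite -(hH N (leqnn N)) min_height_gt0.
pose c := delta / H%:R.
have c0 : 0 < c by rewrite divr_gt0// ltr0n.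
have cB n j : h n j = H -> c < pr mu (B n j).
  by move=> hj; have := height_base_gt n j; rewrite hj /c ltr_pdivrMr ?ltr0n// mulrC.
pose Z m := \bigcup_(j in [set j | h (N + m) j = H]) B (N + m) j.
have mZ m : measurable (Z m).
  by apply: fin_bigcup_measurable => //; exact: finite_finset.
have cZ m : c < pr mu (Z m).
  have hs : h (N + m) (shortest (N + m)) = H by apply: hH; exact: leq_addr.
  apply: lt_le_trans (cB _ _ hs) _; apply: le_pr => // x Bx.
  by exists (shortest (N + m)).
(* A tower of height [H] in the next castle meets the present one, hence contains a full copy; that
   copy has height at least [H] and so fills it entirely, which puts base inside base. *)
have ZS m : Z m.+1 `<=` Z m.
  move=> x [j /= hj Bx]; rewrite addnS in hj Bx.
  have N3m : (N3 <= N + m)%N by rewrite /N; lia.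
  have [l [i [g [y [lh gh yl yg]]]]] := N3P _ N3m (N + m).+1 j.
  have [sp|[i' [a [[ah acop] al]]]] := (href (N + m)%N).2 j l lh.
    have : (level T B (N + m).+1 j l `&` tower_union T B h (N + m) i) y.
      by split => //; exists g.
    by rewrite sp.
  have := min_height_le (N + m) i'; rewrite hH ?leq_addr// => Hi'.
  have [a0 hi'] : a = 0%N /\ h (N + m) i' = H by lia.
  exists i' => //; rewrite -level0; apply: (acop 0%N); first by rewrite hi'.
  by rewrite a0 level0.
pose Zoo := \bigcap_m Z m.
have mZoo : measurable Zoo by apply: bigcap_measurableType => m _.
have cZoo : c <= pr mu Zoo.
  have Zcvg : mu \o Z @ \oo --> mu Zoo.
    apply: nonincreasing_cvg_mu => //.
      by rewrite (le_lt_trans (probability_le1 _ _))// ltry.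
    by apply/nonincreasing_seqP => m; apply/subsetPset; exact: ZS.
  rewrite -lee_fin -prE// -(cvg_lim (@ereal_hausdorff R) Zcvg).
  apply: lime_ge; first exact: cvgP Zcvg.
  by apply: nearW => m /=; rewrite prE// lee_fin ltW.
have [A [mA AZ A0 Ac]] := small_subset mZoo (lt_le_trans c0 cZoo) (divr_gt0 c0 (ltr0n R 2)).
(* An error below [pr mu A] forces a chosen level to meet [A]; that level is a base of measure above
   [c]. An error below [c / 2], with [pr mu A] also below [c / 2], bounds the same measure by
   [c]. *)
have e0 : 0 < Num.min (pr mu A) (c / 2) by rewrite lt_min A0; lra.
have [M MP] := levels_approx mA e0.
have [F Fh] := MP (N + M)%N (leq_addl _ _); rewrite lt_min => /andP[FA Fc].
have mU := measurable_levels_union (N + M) F.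
have mY : measurable (A `+` levels_union T B (N + M) F).
  by apply: measurableU; exact: measurableD.
have [x [Ax [i _ [g Fg xg]]]] : exists x, A x /\ levels_union T B (N + M) F x.
  apply: contrapT => nAU; have := FA; rewrite ltNge => /negP; apply.
  by apply: le_pr => // x Ax; left; split => // Ux; apply: nAU; exists x.
have [j /= hj Bx] := AZ x Ax M I; rewrite -level0 in Bx.
have [ij g0] := level_inj (Fh _ _ Fg) (height_gt0 _ _) xg Bx.
have := cB _ _ hj; rewrite ltNge => /negP; apply.
have BU : B (N + M) j `<=` A `|` (A `+` levels_union T B (N + M) F).
  move=> y By; have [Ay|nAy] := pselect (A y); [by left|right; right].
  by split => //; exists j => //; exists 0%N; [rewrite -g0 -ij|rewrite level0].
by have := pr_le_cover mu (mB _ _) mA mY BU; lra.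
Qed.

(** * Return times when minimal heights grow slowly *)

Definition returns (c : R) n := exists i (m : nat), (0 < m)%N /\
  c * pr mu (B n i) <= pr mu (B n i `&` T m%:Z @^-1` B n i).

Lemma measurable_return n i m : measurable (B n i `&` T m @^-1` B n i).
Proof. by apply: measurableI => //; exact: (measurable_preimage_act hT). Qed.

Lemma two_levels_return n q i j g l l' : (l <= l')%N ->
    level T B q j l `<=` level T B n i g -> level T B q j l' `<=` level T B n i g ->
  pr mu (B q j) <= pr mu (B n i `&` T (l' - l)%N%:Z @^-1` B n i).
Proof.
move=> ll' sl; rewrite -{1}(subnKC ll'); set m := (l' - l)%N => sl'.
rewrite -(pr_level q j l).
rewrite -(pr_image_act hT (- g%:Z) (measurable_level q j l)).
apply: le_pr; first exact/(measurable_image_act hT)/measurable_level.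
  exact: measurable_return.
move=> _ [y yl <-]; split; first exact/levelE/sl.
rewrite /= -(actD hT) addrC (actD hT); apply/levelE/sl'/level_addE.
by rewrite (actK hT).
Qed.

Definition uncovered n q j : pred nat := fun l => `[< forall i g x,
  (g < h n i)%N -> level T B q j l x -> ~ level T B n i g x >].

(** Levels of one tower have equal measure: missing less than [delta / 2] in a tower of measure
    above [delta] means missing fewer than half of its levels. *)
Lemma mostly_covered : exists N, forall n, (N <= n)%N -> forall q j,
  (2 * count (uncovered n q j) (iota 0 (h q j)) < h q j)%N.
Proof.
have [|N NP] := levels_approx measurableT (_ : 0 < delta / 2); first by have := delta_gt0; lra.
exists N => n /NP[F Fh Fd] q j.
have mF := measurable_levels_union n F.
have [mU prU] := pr_bigcup_count (measurable_level q j) (pr_level q j)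
  (@levels_trivIset q j (uncovered n q j)).
have : (count (uncovered n q j) (iota 0 (h q j)))%:R * pr mu (B q j) < delta / 2.
  rewrite -prU; apply: le_lt_trans Fd; apply: le_pr => //.
    by apply: measurableU; apply: measurableD.
  move=> x [l /= /andP[lh /asboolP ul] xl]; left; split => // -[i _ [g Fg xg]].
  exact: ul (Fh _ _ Fg) xl xg.
have := height_base_gt q j; have := base_gt0 q j; set c := count _ _ => b0 hb cb.
rewrite -(ltr_nat R) natrM -(ltr_pM2r b0); lra.
Qed.

(** If no level of castle [n] is visited twice, tower [j] has at most [h n i] levels inside tower
    [i]. More than half of its levels are covered by the [k] towers, so some tower [i] receives a
    proportion at least 1 / (2 k). *)
Lemma tall_or_return : exists N, forall n, (N <= n)%N -> forall q, (n <= q)%N -> forall j,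
  (exists i (m : nat), (0 < m)%N /\
     pr mu (B q j) <= pr mu (B n i `&` T m%:Z @^-1` B n i)) \/
  (exists i, (h n i <= h q j <= 2 * k * h n i)%N).
Proof.
have [N NP] := mostly_covered; exists N => n Nn q nq j.
have [?|nret] := pselect (exists i (m : nat), (0 < m)%N /\
     pr mu (B q j) <= pr mu (B n i `&` T m%:Z @^-1` B n i)); [by left|right].
pose meets i : pred nat := fun l => `[< exists g, (g < h n i)%N /\
  level T B q j l `<=` level T B n i g >].
have meets_le i : (count (meets i) (iota 0 (h q j)) <= h n i)%N.
  rewrite -size_filter; set s := seq.filter _ _.
  have /choice[f fP] : forall l, exists g, l \in s ->
      (g < h n i)%N /\ level T B q j l `<=` level T B n i g.
    move=> l; have [ls|ls] := boolP (l \in s); last by exists 0%N.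
    have := ls; rewrite mem_filter => /andP[/asboolP[g gP] _].
    by exists g.
  have f_inj : {in s &, injective f}.
    have aux a b : a \in s -> b \in s -> (a < b)%N -> f a = f b -> False.
      move=> /fP[fa sa] /fP[fb sb] ab fab; apply: nret; exists i, (b - a)%N.
      rewrite subn_gt0 ab; split => //; apply: (@two_levels_return _ _ _ _ (f a)) => //.
        exact: ltnW.
      by rewrite fab.
    move=> a b sa sb fab; case: (ltngtP a b) => // ab.
      by case: (aux a b).
    by case: (aux b a).
  rewrite -(size_map f) -[leqRHS](size_iota 0); apply: uniq_leq_size.
    by rewrite map_inj_in_uniq// filter_uniq// iota_uniq.
  by move=> _ /mapP[l /fP[fl _] ->]; rewrite mem_iota.
have cover : (count (predC (uncovered n q j)) (iota 0 (h q j)) <=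
    \sum_(i <- index_enum 'I_k) count (meets i) (iota 0 (h q j)))%N.
  apply: leq_trans (count_has_le _ _ _).
  rewrite -!size_filter; apply: uniq_leq_size; first by rewrite filter_uniq// iota_uniq.
  move=> l; rewrite !mem_filter => /andP[/= + lq]; rewrite lq andbT.
  move: lq; rewrite mem_iota /= add0n => lh /asboolPn/existsNP[i /existsNP[g /existsNP[x]]].
  move=> /not_implyP[gh /not_implyP[xl /contrapT xg]].
  apply/hasP; exists i; first exact: mem_index_enum.
  by apply/asboolP; exists g; split => //; exact: (level_sub nq gh lh xg xl).
have half := NP n Nn q j; have := count_predC (uncovered n q j) (iota 0 (h q j)).
rewrite size_iota => tot.
have [i0 i0P] : exists i, (h q j <= 2 * k * count (meets i) (iota 0 (h q j)))%N.
  apply: contrapT => /forallNP ni.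
  have : (\sum_(i <- index_enum 'I_k) (2 * k * count (meets i) (iota 0 (h q j))) <=
      \sum_(i < k) (h q j).-1)%N.
    by apply: leq_sum => i _; have /negP := ni i; rewrite -ltnNge; lia.
  rewrite -big_distrr /= sum_nat_const card_ord; move: cover half tot k_gt0.
  set S := (\sum_(i <- _) _)%N; set a := count _ _; set b := count _ _; nia.
exists i0; rewrite (leq_trans i0P) ?leq_mul2l ?meets_le ?orbT// andbT.
have : (0 < count (meets i0) (iota 0 (h q j)))%N.
  by rewrite lt0n; apply/eqP => c0; have := height_gt0 q j; move: i0P; rewrite c0; lia.
rewrite -has_count => /hasP[l]; rewrite mem_iota add0n => /= lh /asboolP[g [gh sub]].
have [x xl] := level_nonempty q j l.
exact: (height_le nq gh lh (sub _ xl) xl).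
Qed.

Lemma slow_growth_returns (C : nat) : exists2 c : R, 0 < c &
  exists N, forall n, (N <= n)%N ->
    (forall p, (n <= p)%N -> (min_height p.+1 <= C * min_height p)%N) ->
  returns c n.
Proof.
(* [D] is the ratio from [tall_or_return]. Between successive stages [qs t] the minimal height grows
   by a factor above [D] and at most [C * D], so [M] bounds its growth up to t = k. *)
pose D := (2 * k)%N; pose M := ((C * D).+1 ^ k)%N.
have M0 : 0 < M%:R :> R by rewrite ltr0n expn_gt0.
exists (delta / M%:R); first exact: divr_gt0.
have [N NP] := tall_or_return; exists N => n Nn slow.
have D0 : (0 < D)%N by rewrite muln_gt0.
have next q : exists q', (n <= q)%N ->
    [/\ (q < q')%N, (D * min_height q < min_height q')%N &
        (min_height q' <= C * D * min_height q)%N].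
  have [nq|] := leqP n q; last by exists 0%N.
  have [L LP] := min_height_unbounded (D * min_height q).+1.
  have ex : exists q', (q <= q')%N && (D * min_height q < min_height q')%N.
    by exists (maxn q L); rewrite leq_maxl LP// leq_maxr.
  (* By minimality the stage before [q'] has minimal height at most [D * min_height q], and one slow
     step multiplies it by at most [C]. *)
  case: (ex_minnP ex) => q' /andP[qq' Dq'] qmin; exists q' => _.
  have qlt : (q < q')%N.
    rewrite ltn_neqAle qq' andbT; apply/eqP => E.
    by move: Dq'; rewrite -E; have := min_height_gt0 q; nia.
  split => //; case: q' => // q' in qq' Dq' qmin qlt *.
  have nq' : (n <= q')%N by lia.
  apply: (leq_trans (slow q' nq')); rewrite -mulnA leq_mul2l.
  apply/orP; right; rewrite leqNgt; apply/negP => Dq.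
  have := qmin q'; rewrite Dq andbT => /(_ _); lia.
have {}[nx nxP] := choice next; pose qs t := iter t nx n.
have nqs t : (n <= qs t)%N.
  by elim: t => //= t IH; have [/ltnW/(leq_trans IH)] := nxP _ IH.
have qs_lt s t : (s < t)%N -> (D * min_height (qs s) < min_height (qs t))%N.
  elim: t => // t IH; have [_ lt _] := nxP _ (nqs t).
  rewrite ltnS leq_eqVlt => /predU1P[->//|/IH h1].
  by apply: (ltn_trans h1); apply: leq_ltn_trans lt; rewrite leq_pmull.
have qs_le t : (min_height (qs t) <= (C * D).+1 ^ t * min_height n)%N.
  elim: t => [|t IH]; first by rewrite mul1n.
  have [_ _ le] := nxP _ (nqs t); apply: (leq_trans le).
  by rewrite expnS -[leqRHS]mulnA leq_mul.
have [[t tP]|nret] := pselect (exists t : 'I_k.+1, exists i (m : nat), (0 < m)%N /\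
    pr mu (B (qs t) (shortest (qs t))) <= pr mu (B n i `&` T m%:Z @^-1` B n i)).
  (* The base at stage [qs t] has measure above [delta / (M * h n i)], while that of tower [i] has
     measure at most [1 / h n i]. *)
  have [i [m [m0 le]]] := tP; exists i, m; split => //; apply: le_trans le.
  have hb := height_base_gt (qs t) (shortest (qs t)).
  have hi := height_base_le n i.
  have := base_gt0 n i; have := base_gt0 (qs t) (shortest (qs t)).
  have hM : (min_height (qs t) <= M * h n i)%N.
    apply: leq_trans (qs_le t) _; rewrite leq_mul ?min_height_le//.
    by rewrite leq_pexp2l// -ltnS.
  move: hb; rewrite -[h (qs t) _]/(min_height (qs t)).
  move: hi hM; rewrite -(ler_nat R) natrM.
  set x := pr mu _; set y := pr mu _; set a := (min_height _)%:R.
  move=> hi hM hb y0 x0; rewrite mulrAC ler_pdivrMr//.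
  have : a * y <= M%:R * (h n i)%:R * y by rewrite ler_wpM2r// ltW.
  have : M%:R * y * ((h n i)%:R * x) <= M%:R * y * 1.
    by rewrite ler_wpM2l// mulr_ge0// ltW.
  have : delta * x <= a * y * x by rewrite ler_wpM2r// ltW.
  have : a * y * x <= M%:R * (h n i)%:R * y * x by rewrite ler_wpM2r ?(ltW x0)// ler_wpM2r// ltW.
  lra.
have /choice[f fP] : forall t : 'I_k.+1, exists i,
    (h n i <= min_height (qs t) <= D * h n i)%N.
  move=> t; have [ret|//] := NP n Nn (qs t) (nqs t) (shortest (qs t)).
  by exfalso; apply: nret; exists t.
(* A common value at s < t would give [min_height (qs t) <= D * h n (f s) <= D * min_height (qs s)],
   against [qs_lt]. Injectivity is absurd, as k + 1 stages would embed into k towers. *)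
have f_inj : injective f.
  have aux (s t : 'I_k.+1) : (s < t)%N -> f s = f t -> False.
    move=> /qs_lt lt E; have /andP[h1 _] := fP s; have /andP[_ h2] := fP t.
    rewrite -E in h2; have : (D * h n (f s) <= D * min_height (qs s))%N by rewrite leq_mul2l h1 orbT.
    by move: lt h2; lia.
  move=> s t E; apply/val_inj; case: (ltngtP s t) => // st.
    by case: (aux s t).
  by case: (aux t s).
by have := leq_card f f_inj; rewrite !card_ord ltnn.
Qed.

(** * Copies of towers inside the next castle *)

Variable r : nat.
Hypothesis hsp : spacers_bounded T B h r.

(** If [b] fell inside the copy at [a], its level would lie both in the base of tower [i'] and in a
    level of tower [i] of positive index. *)
Lemma tower_copy_disjoint p j i i' a b :
    tower_copy T B h p j i a -> tower_copy T B h p j i' b -> (a < b)%N ->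
  (a + h p i <= b)%N.
Proof.
move=> [_ ca] [_ cb] ab; rewrite leqNgt; apply/negP => ba.
have [x xb] := level_nonempty p.+1 j b.
have bh : (b - a < h p i)%N by lia.
have xi : level T B p i (b - a) x by apply: ca => //; rewrite subnKC// ltnW.
have xi' : level T B p i' 0 x by apply: cb; rewrite ?addn0 ?height_gt0.
by have [_] := level_inj bh (height_gt0 _ _) xi xi'; lia.
Qed.

Lemma tower_copy_inj p j i i' a :
  tower_copy T B h p j i a -> tower_copy T B h p j i' a -> i = i'.
Proof.
move=> [_ ca] [_ cb]; have [x xa] := level_nonempty p.+1 j a.
have xi : level T B p i 0 x by apply: ca; rewrite ?addn0 ?height_gt0.
have xi' : level T B p i' 0 x by apply: cb; rewrite ?addn0 ?height_gt0.
by have [] := level_inj (height_gt0 _ _) (height_gt0 _ _) xi xi'.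
Qed.

(** The level is not a spacer, so it lies in some copy, and disjointness of the levels of castle [p]
    forces its position there to be 0. *)
Lemma tower_copy_base p j i l : (l < h p.+1 j)%N ->
  level T B p.+1 j l `<=` B p i -> tower_copy T B h p j i l.
Proof.
move=> lh sub; have [x xl] := level_nonempty p.+1 j l.
have xi : level T B p i 0 x by rewrite level0; exact: sub.
have [sp|[i' [a [ca al]]]] := (href p).2 j l lh.
  have : (level T B p.+1 j l `&` tower_union T B h p i) x.
    by split => //; exists 0%N => //; exact: height_gt0.
  by rewrite sp.
have lah : (l - a < h p i')%N by lia.
have xi' : level T B p i' (l - a) x by apply: ca.2 => //; rewrite subnKC//; lia.
have [<- la] := level_inj lah (height_gt0 _ _) xi' xi.
by rewrite (_ : l = a)//; lia.
Qed.

(** A level between consecutive copies is a spacer: a copy containing it would start before, at or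
    after [a], contradicting disjointness or the choice of [b]. *)
Lemma tower_copy_gap p j i i' a b : (0 < p)%N ->
    tower_copy T B h p j i a -> tower_copy T B h p j i' b -> (a < b)%N ->
    (forall c i'', tower_copy T B h p j i'' c -> (a < c)%N -> (b <= c)%N) ->
  (b - (a + h p i) <= r)%N.
Proof.
move=> p0 ca cb ab nocopy.
apply: (hsp p0 ca cb (tower_copy_disjoint ca cb ab)) => l /andP[al lb].
have lh : (l < h p.+1 j)%N.
  by apply: (leq_trans lb); apply: leq_trans cb.1; exact: leq_addr.
have [//|[i3 [c [cc /andP[cl lc]]]]] := (href p).2 j l lh; exfalso.
have [ac|ca'|E] := ltngtP a c.
- by have := nocopy _ _ cc ac; lia.
- by have := tower_copy_disjoint cc ca ca'; lia.
- by rewrite -E in cc lc; rewrite (tower_copy_inj cc ca) in lc; lia.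
Qed.

Definition copy_starts p j : seq nat :=
  [seq a <- iota 0 (h p.+1 j) | `[< exists i, tower_copy T B h p j i a >]].

Lemma mem_copy_starts p j a : a \in copy_starts p j <->
  exists i, tower_copy T B h p j i a.
Proof.
rewrite mem_filter mem_iota /= add0n; split=> [/andP[/asboolP//]|[i ca]].
apply/andP; split; first by apply/asboolP; exists i.
by apply: leq_trans ca.1; rewrite -addn1 leq_add2l height_gt0.
Qed.

Lemma sorted_copy_starts p j : sorted ltn (copy_starts p j).
Proof. by apply: sorted_filter; [exact: ltn_trans|exact: iota_ltn_sorted]. Qed.

(** Possible distances between starts of consecutive copies: a tower height plus at most [r]
    spacers. Their number is independent of [p]. *)
Definition jumps p : seq nat :=
  [seq (h p i + s)%N | i <- enum 'I_k, s <- iota 0 r.+1].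

Lemma size_jumps p : size (jumps p) = (k * r.+1)%N.
Proof. by rewrite size_allpairs size_enum_ord size_iota. Qed.

Lemma copy_starts_step p j t : (0 < p)%N -> (t.+1 < size (copy_starts p j))%N ->
  (nth 0 (copy_starts p j) t.+1 - nth 0 (copy_starts p j) t)%N \in jumps p.
Proof.
move=> p0 ts; set st := copy_starts p j in ts *.
have stm u v : (u < v)%N -> (v < size st)%N -> (nth 0 st u < nth 0 st v)%N.
  move=> uv vs; apply: (sorted_ltn_nth ltn_trans) => //.
  - exact: sorted_copy_starts.
  - by rewrite inE (ltn_trans uv).
have /mem_copy_starts[i ca] : nth 0%N st t \in st by rewrite mem_nth// ltnW.
have /mem_copy_starts[i' cb] : nth 0%N st t.+1 \in st by rewrite mem_nth.
have ab := stm _ _ (ltnSn t) ts.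
have gap : (nth 0 st t.+1 - (nth 0 st t + h p i) <= r)%N.
  apply: (tower_copy_gap p0 ca cb ab) => c i'' cc ac.
  have cst : c \in st by apply/mem_copy_starts; exists i''.
  have cs : (index c st < size st)%N by rewrite index_mem.
  rewrite -(nth_index 0%N cst) in ac *.
  have [tc|ct] := ltnP t (index c st).
    by move: tc; rewrite leq_eqVlt => /predU1P[->//|/stm/(_ cs)/ltnW].
  move: ct; rewrite leq_eqVlt => /predU1P[E|ct]; first by rewrite E ltnn in ac.
  by have := ltn_trans ac (stm _ _ ct (ltnW ts)); rewrite ltnn.
have dis := tower_copy_disjoint ca cb ab.
apply/allpairsP; exists (i, nth 0 st t.+1 - (nth 0 st t + h p i))%N.
split; [exact: mem_enum|by rewrite mem_iota ltnS|rewrite /=].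
by rewrite subnDA subnKC// leq_subRL// ltnW.
Qed.

Lemma size_copy_starts p j : (size (copy_starts p j) * min_height p <= h p.+1 j)%N.
Proof.
set st := copy_starts p j.
have sP t : (t < size st)%N -> exists i, tower_copy T B h p j i (nth 0%N st t).
  by move=> ts; apply/mem_copy_starts; rewrite mem_nth.
have lower t : (t < size st)%N -> (t * min_height p <= nth 0 st t)%N.
  elim: t => // t IH ts; have [i ca] := sP _ (ltnW ts); have [i' cb] := sP _ ts.
  have ab : (nth 0 st t < nth 0 st t.+1)%N.
    apply: (sorted_ltn_nth ltn_trans) => //; first exact: sorted_copy_starts.
    by rewrite inE ltnW.
  apply: leq_trans (tower_copy_disjoint ca cb ab).
  by rewrite mulSn addnC leq_add ?IH ?min_height_le// ltnW.
have [->//|s0] := posnP (size st).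
have slt : ((size st).-1 < size st)%N by rewrite prednK.
have [i [le _]] := sP _ slt; rewrite -(prednK s0) mulSn addnC.
by apply: leq_trans le; rewrite leq_add ?lower ?min_height_le.
Qed.

(** The base of tower [i] is covered by the levels of castle [q] inside it; among the [k] towers
    carrying them, one has at least the average share. *)
Lemma heavy_tower n q i : (n <= q)%N -> exists j, pr mu (B n i) <=
  k%:R * ((count (fun l => `[< level T B q j l `<=` B n i >]) (iota 0 (h q j)))%:R
    * pr mu (B q j)).
Proof.
move=> nq; pose Q j : pred nat := fun l => `[< level T B q j l `<=` B n i >].
have QU j := pr_bigcup_count (measurable_level q j) (pr_level q j)
  (@levels_trivIset q j (Q j)).
have sum : pr mu (B n i) <=
    \sum_(j <- index_enum 'I_k) (count (Q j) (iota 0 (h q j)))%:R * pr mu (B q j).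
  under eq_bigr do rewrite -(QU _).2.
  apply: pr_le_sum => [j||x Bx]; [exact: (QU j).1|exact: mB|].
  rewrite -level0 in Bx; have [j [l [lh xl]]] := level_covered nq (height_gt0 n i) Bx.
  exists j; first exact: mem_index_enum.
  exists l => //=; rewrite lh; apply/asboolP; rewrite -level0.
  exact: (level_sub nq (height_gt0 n i) lh Bx xl).
apply: contrapT => /forallNP lt.
have : \sum_(j <- index_enum 'I_k)
      (k%:R * ((count (Q j) (iota 0 (h q j)))%:R * pr mu (B q j))) <
    \sum_(j < k) pr mu (B n i).
  apply: ltr_sum => [|j _]; last by rewrite ltNge; apply/negP/lt.
  by apply/hasP; exists (Ordinal k_gt0) => //; exact: mem_index_enum.
rewrite -mulr_sumr sumr_const card_ord -[ltRHS]mulr_natl ltr_pM2l ?ltr0n//.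
by rewrite ltNge sum.
Qed.

Lemma growth_or_returns : exists (C : nat) (c : R), 0 < c /\
  forall p, (0 < p)%N -> (min_height p.+1 <= C * min_height p)%N \/ returns c p.
Proof.
have kd0 : 0 <= k%:R / delta by rewrite divr_ge0 ?ler0n// ltW.
(* [C] serves twice: as the growth factor when tower [j] contains at most one copy of the shortest
   tower, and as the [K] of [frequent_return] otherwise. *)
pose C := Num.bound (k%:R / delta).
have kC : k%:R <= C%:R * delta.
  by rewrite -ler_pdivrMr// ltW// (archi_boundP kd0).
have C0 : (0 < C)%N.
  rewrite -(ltr0n R); apply: (le_lt_trans kd0); exact: (archi_boundP kd0).
pose M := (4 * (k * r.+1).+1 ^ (4 * C))%N.
have M0 : 0 < M%:R :> R by rewrite ltr0n muln_gt0 expn_gt0.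
have k0 : 0 < k%:R :> R by rewrite ltr0n.
exists C, (k%:R * M%:R)^-1; split; first by rewrite invr_gt0 mulr_gt0.
move=> p p0; pose i := shortest p.
have [j heavy] := heavy_tower i (leqnSn p).
set Q : pred nat := fun l => `[< _ >] in heavy.
set cnt := count _ _ in heavy.
have hb := height_base_gt p i; rewrite -[h p i]/(min_height p) in hb.
have hj := height_base_le p.+1 j.
have b0 := base_gt0 p i; have bj0 := base_gt0 p.+1 j.
set b := pr mu (B p i) in hb b0 heavy.
set bj := pr mu (B p.+1 j) in hj bj0 heavy.
have [cnt1|cnt2] := leqP cnt 1.
  (* Here [b <= k * bj]; with [min_height p * b > delta] and [h p.+1 j * bj <= 1] this bounds
     [h p.+1 j] by [(k / delta) * min_height p]. *)
  left; apply: leq_trans (min_height_le _ j) _.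
  have bk : b <= k%:R * bj.
    apply: le_trans heavy _; rewrite ler_wpM2l ?(ltW k0)//.
    by rewrite ler_piMl ?(ltW bj0)// lern1.
  rewrite -(ler_nat R) natrM -(ler_pM2r delta_gt0).
  have e1 : (h p.+1 j)%:R * delta <= (h p.+1 j)%:R * ((min_height p)%:R * b).
    by rewrite ler_wpM2l// ltW.
  have e2 : (h p.+1 j)%:R * (min_height p)%:R * b <=
      (h p.+1 j)%:R * (min_height p)%:R * (k%:R * bj) by rewrite ler_wpM2l// mulr_ge0.
  have e3 : (min_height p)%:R * k%:R * ((h p.+1 j)%:R * bj) <=
      (min_height p)%:R * k%:R * 1 by rewrite ler_wpM2l// mulr_ge0// ltW.
  have e4 : (min_height p)%:R * k%:R <= (min_height p)%:R * (C%:R * delta).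
    by rewrite ler_wpM2l.
  lra.
right.
have Qst a : Q a -> (a < h p.+1 j)%N -> a \in copy_starts p j.
  by move=> /asboolP Qa ah; apply/mem_copy_starts; exists i; exact: tower_copy_base.
have cntE : count Q (copy_starts p j) = cnt.
  rewrite /cnt count_filter; apply: eq_in_count => a; rewrite mem_iota add0n => /= ah.
  have [Qa|//] := boolP (Q a).
  by apply/asboolP/mem_copy_starts; exact: Qst.
(* All copies have height at least [min_height p], so their number times [delta] is at most [h p.+1
   j * b <= k * cnt * (h p.+1 j * bj) <= k * cnt]. *)
have few : (size (copy_starts p j) <= C * count Q (copy_starts p j))%N.
  rewrite cntE -(ler_nat R) natrM -(ler_pM2r delta_gt0).
  set N := (size (copy_starts p j))%:R.
  have sz : N * (min_height p)%:R <= (h p.+1 j)%:R :> R.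
    by rewrite -natrM ler_nat size_copy_starts.
  have e1 : N * delta <= N * ((min_height p)%:R * b) by rewrite ler_wpM2l// ltW.
  have e2 : N * (min_height p)%:R * b <=
      N * (min_height p)%:R * (k%:R * (cnt%:R * bj)) by rewrite ler_wpM2l// mulr_ge0.
  have e3 : k%:R * cnt%:R * bj * (N * (min_height p)%:R) <=
      k%:R * cnt%:R * bj * (h p.+1 j)%:R.
    by rewrite ler_wpM2l// !mulr_ge0// ltW.
  have e4 : k%:R * cnt%:R * ((h p.+1 j)%:R * bj) <= k%:R * cnt%:R * 1.
    by rewrite ler_wpM2l// mulr_ge0// ltW.
  have e5 : cnt%:R * k%:R <= cnt%:R * (C%:R * delta) by rewrite ler_wpM2l.
  lra.
have [|m m0 mP] := frequent_return (sorted_copy_starts p j)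
  (fun t => @copy_starts_step p j t p0) C0 few; first by rewrite cntE.
rewrite size_jumps cntE -/M in mP.
set P : pred nat := fun a => [&& Q a, _ & _] in mP.
exists i, m; split => //.
have [mU prU] := pr_bigcup_count (measurable_level p.+1 j) (pr_level p.+1 j)
  (@levels_trivIset p.+1 j P).
have UR : (count P (iota 0 (h p.+1 j)))%:R * bj <= pr mu (B p i `&` T m%:Z @^-1` B p i).
  rewrite -prU; apply: le_pr => //; first exact: measurable_return.
  move=> x [a /= /andP[ah /and3P[/asboolP Qa _ /asboolP Qad]] xa]; split.
    exact: Qa.
  by apply: Qad; apply/level_addE; rewrite (actK hT).
apply: le_trans UR; rewrite -/b ler_pdivrMl ?mulr_gt0//.
apply: (le_trans heavy); rewrite -mulrA ler_pM2l// mulrA ler_wpM2r ?(ltW bj0)//.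
rewrite -natrM ler_nat (leq_trans mP)// leq_mul2l; apply/orP; right.
by rewrite /copy_starts count_filter sub_count// => a /andP[].
Qed.

(** If no stage from [n] on has returns with constant [c], then all of them grow slowly and
    [slow_growth_returns] applies at [n]. *)
Lemma returns_infinitely_often : exists2 c : R, 0 < c &
  forall N, exists2 n, (N <= n)%N & returns c n.
Proof.
have [C [c [c0 cP]]] := growth_or_returns.
have [c' c'0 [N' N'P]] := slow_growth_returns C.
have weaken (a b : R) n : b <= a -> returns a n -> returns b n.
  move=> ba [i [m [m0 le]]]; exists i, m; split => //; apply: le_trans le.
  by rewrite ler_wpM2r ?pr_ge0.
exists (Num.min c c'); first by rewrite lt_min c0.
(* The successor keeps the stages positive, as [growth_or_returns] requires. *)
move=> N; pose n := maxn N'.+1 N.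
have [[p np]|nret] := pselect (exists2 p, (n <= p)%N & returns c p).
  by exists p; [rewrite (leq_trans _ np)// leq_maxr|apply: (@weaken c) => //; rewrite ge_min lexx].
exists n; first exact: leq_maxr.
apply: (@weaken c'); first by rewrite ge_min lexx orbT.
apply: N'P => [|p np]; first by rewrite /n; lia.
have [|//|ret] := cP p; first by rewrite /n in np; lia.
by exfalso; apply: nret; exists p.
Qed.

(** * From return times to partial rigidity *)

Lemma return_time_ge n i (m : nat) : (0 < m)%N ->
  0 < pr mu (B n i `&` T m%:Z @^-1` B n i) -> (h n i <= m)%N.
Proof.
move=> m0 ret0; rewrite leqNgt; apply/negP => mh.
have : B n i `&` T m%:Z @^-1` B n i = set0; last by move=> E; rewrite E pr0 ltxx in ret0.
apply/seteqP; split => // x [Bx /= BTx].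
have xm : level T B n i m (T m%:Z x) by exists x.
have x0 : level T B n i 0 (T m%:Z x) by rewrite level0.
by have [_ m_eq0] := level_inj mh (height_gt0 _ _) xm x0; rewrite m_eq0 in m0.
Qed.

Lemma pr_tower_boundary n i :
  pr mu (tower_union T B h n i `\` T 1 @^-1` tower_union T B h n i) <= pr mu (B n i).
Proof.
have mW := measurable_tower_union n i.
rewrite -(pr_level n i (h n i).-1); apply: le_pr => [||x [[g gh xg] nTx]].
- by apply: measurableD => //; exact: (measurable_preimage_act hT).
- exact: measurable_level.
- have [gE|gE] := eqVneq g (h n i).-1; first by rewrite -gE.
  exfalso; apply: nTx; exists (g + 1)%N; first by rewrite /= in gh *; lia.
  by apply/level_addE; rewrite (actK hT).
Qed.

(** Moved by [m + g], the set [S] lies in level [g] and in its image under [T m]. Summing over the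
    levels of the tower that belong to [U] gives the estimate for [U]; exchanging [A] and [U] costs
    [e] once on the left and twice on the right. *)
Lemma rigidity_at_return n i (m : nat) (c e : R) A F : 0 < c -> measurable A ->
    castle_index h n F -> pr mu (A `+` levels_union T B n F) < e ->
    c * pr mu (B n i) <= pr mu (B n i `&` T m%:Z @^-1` B n i) ->
  c * (pr mu (A `&` tower_union T B h n i) - e) <= pr mu (A `&` T m%:Z @` A) + 2 * e.
Proof.
move=> c0 mA Fh; set U := levels_union T B n F; set W := tower_union T B h n i.
set S := B n i `&` _ => Ae ret.
have mU : measurable U := measurable_levels_union n F.
have mW : measurable W := measurable_tower_union n i.
have mS : measurable S := measurable_return n i m.
have mY : measurable (A `+` U) by apply: measurableU; exact: measurableD.
have mTA := measurable_image_act hT m%:Z mA.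
have mTY := measurable_image_act hT m%:Z mY.
have mTU := measurable_image_act hT m%:Z mU.
pose G : pred nat := fun g => `[< F i g >].
have UW : pr mu (U `&` W) <= (count G (iota 0 (h n i)))%:R * pr mu (B n i).
  have [mV <-] := pr_bigcup_count (measurable_level n i) (pr_level n i)
    (@levels_trivIset n i G).
  apply: le_pr => //; first exact: measurableI.
  move=> x [[j _ [g Fg xg]] [g' gh xg']].
  have [ji gg'] := level_inj (Fh _ _ Fg) gh xg xg'.
  rewrite ji gg' in Fg; exists g' => //=.
  by apply/andP; split => //; exact/asboolP.
pose V g := T (m%:Z + g%:Z) @` S.
have mV g : measurable (V g) by exact: (measurable_image_act hT).
have prV g : pr mu (V g) = pr mu S by exact: (pr_image_act hT).
have Vlev g : V g `<=` level T B n i g.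
  move=> _ [x [_ BTx] <-]; rewrite addrC (actD hT).
  by exists (T m%:Z x).
have tV : trivIset [set g | (g < h n i)%N && G g] V.
  move=> g g' /= /andP[gh _] /andP[gh' _] [x [/Vlev xg /Vlev xg']].
  by have [] := level_inj gh gh' xg xg'.
have [mVV prVV] := pr_bigcup_count mV prV tV.
have UTU : (count G (iota 0 (h n i)))%:R * pr mu S <= pr mu (U `&` T m%:Z @` U).
  rewrite -prVV; apply: le_pr => //; first exact: measurableI.
  move=> x [g /= /andP[gh /asboolP Fg] xg]; split.
    by exists i => //; exists g => //; exact: Vlev.
  have [y [By _] <-] := xg; rewrite (actD hT); exists (T g%:Z y) => //.
  by exists i => //; exists g => //; exists y.
have AW : pr mu (A `&` W) <= pr mu (U `&` W) + pr mu (A `+` U).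
  apply: pr_le_cover => //; try exact: measurableI.
  move=> x [Ax Wx]; have [Ux|nUx] := pselect (U x); first by left.
  by right; left.
have TAU : pr mu (U `&` T m%:Z @` U) <= pr mu (A `&` T m%:Z @` A) +
    pr mu ((A `+` U) `|` T m%:Z @` (A `+` U)).
  apply: pr_le_cover; [exact: measurableI..|exact: measurableU|].
  move=> x [Ux [y Uy yx]]; have [Ax|nAx] := pselect (A x); last by right; left; right.
  have [Ay|nAy] := pselect (A y); first by left; split => //; exists y.
  by right; right; exists y => //; right.
have YY : pr mu ((A `+` U) `|` T m%:Z @` (A `+` U)) <=
    pr mu (A `+` U) + pr mu (A `+` U).
  rewrite -{2}(pr_image_act hT m%:Z mY); apply: pr_le_cover => //.
  exact: measurableU.
have cUW : c * pr mu (U `&` W) <= (count G (iota 0 (h n i)))%:R * pr mu S.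
  apply: le_trans (_ : (count G (iota 0 (h n i)))%:R * (c * pr mu (B n i)) <= _).
    by rewrite mulrCA ler_pM2l.
  by rewrite ler_wpM2l.
have cAW : c * pr mu (A `&` W) <= c * (pr mu (U `&` W) + pr mu (A `+` U)).
  by rewrite ler_pM2l.
have cY : c * pr mu (A `+` U) <= c * e by rewrite ler_pM2l// ltW.
lra.
Qed.

Hypothesis herg : ergodic mu T.

Lemma castles_partially_rigid : partially_rigid mu T.
Proof.
have [c c0 ret] := returns_infinitely_often.
have /choice[F FP] : forall K : nat, exists p : nat * 'I_k * nat,
    [/\ (K <= p.1.1)%N, (K <= p.2)%N & c * pr mu (B p.1.1 p.1.2) <=
      pr mu (B p.1.1 p.1.2 `&` T p.2%:Z @^-1` B p.1.1 p.1.2)].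
  move=> K; have [N NP] := min_height_unbounded K.
  have [n] := ret (maxn N K); rewrite geq_max => /andP[Nn Kn] [i [m [m0 le]]].
  exists (n, i, m); split => //=; apply: leq_trans (NP n Nn) _.
  apply: leq_trans (min_height_le n i) _; apply: return_time_ge => //.
  by apply: lt_le_trans le; rewrite mulr_gt0// base_gt0.
(* [s t.+1] exceeds the return time chosen at [s t], and the time chosen at [K] is at least [K], so
   the times increase strictly. *)
pose s t := iter t (fun K => (maxn K (F K).2).+1) 0%N.
have s_ge t : (t <= s t)%N by elim: t => //= t IH; rewrite ltnS (leq_trans IH)// leq_maxl.
exists (c * delta), (fun t => (F (s t)).2%:Z); split; first exact: mulr_gt0.
  apply/increasing_seqP => t; rewrite ltz_nat.
  have [_ + _] := FP (s t.+1); apply: leq_trans.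
  by rewrite /= ltnS leq_maxr.
move=> A mA; rewrite prE// -EFinM.
apply/lee_addgt0Pr => e e0.
(* The errors total [3 * c + 2] times [e']: [2 * c] from independence and the tower boundary,
   [c + 2] from [rigidity_at_return]. *)
pose e' := e / (3 * c + 2).
have e'0 : 0 < e' by rewrite divr_gt0//; lra.
have [C C0 CP] := almost_invariant_independent hT herg mA e'0.
have [N1 N1P] := levels_approx mA e'0.
(* Heights at least [C / e'] make [C] times the measure of the tower boundary at most [e']. *)
have [N2 N2P] := min_height_unbounded (Num.bound (C / e')).
rewrite -leeBlDr//.
rewrite limn_einf_lim; apply: lime_ge; first exact: is_cvg_einfs.
exists (maxn N1 N2) => // t; rewrite /= geq_max => /andP[t1 t2].
apply/ereal_infP => _ [u /= tu <-].
have mTA := measurable_image_act hT (F (s u)).2 mA.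
rewrite prE; last exact: measurableI.
rewrite -EFinB lee_fin.
have [sn _ rt] := FP (s u); move: sn rt; case: (F (s u)) => [[n i] m] /= sn rt.
have un : (t <= n)%N by rewrite (leq_trans tu)// (leq_trans (s_ge u)).
have [G Gh Ge] := N1P n (leq_trans t1 un).
have := rigidity_at_return c0 mA Gh Ge rt.
have := CP _ (measurable_tower_union n i); have := pr_tower_boundary n i.
have := hdelta n i; set W := tower_union T B h n i.
set b := pr mu (W `\` _) => Wd bB CW rig.
have Cb : C * b <= e'.
  have hC : C <= (h n i)%:R * e'.
    rewrite -ler_pdivrMr//; apply: le_trans (ltW (archi_boundP _)) _.
      by rewrite divr_ge0// ltW.
    by rewrite ler_nat (leq_trans (N2P n (leq_trans t2 un)))// min_height_le.
  have bb : C * b <= C * pr mu (B n i) by rewrite ler_wpM2l.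
  have hb : C * pr mu (B n i) <= (h n i)%:R * e' * pr mu (B n i).
    by rewrite ler_wpM2r ?pr_ge0.
  have : e' * ((h n i)%:R * pr mu (B n i)) <= e' * 1.
    by rewrite ler_pM2l// height_base_le.
  lra.
have Ad : pr mu A * delta <= pr mu A * pr mu W by rewrite ler_wpM2l ?pr_ge0// ltW.
have : c * (pr mu A * delta) <= c * (pr mu (A `&` W) + 2 * e') by rewrite ler_pM2l//; lra.
have : e = e' * (3 * c + 2) by rewrite /e' divfK// gt_eqF//; lra.
lra.
Qed.

End Castles.

Theorem theorem6p4 (R : realType) (d : measure_display) (X : measurableType d)
  (mu : probability X R) (T : int -> X -> X)
  (hstd : standard_borel R X) (hna : non_atomic mu)
  (hT : pp_Zaction mu T) (herg : ergodic mu T)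
  (hqe : quasi_exact_finite_rank mu T) :
  partially_rigid mu T.
Proof.
have [k k0 [B [h [[mB hdisj hgen] href [delta [r [delta0 r0 hsp hmin]]]]]]] := hqe.
have hdelta n j : delta < pr mu (tower_union T B h n j).
  have mW : measurable (tower_union T B h n j).
    by apply: bigcup_measurable => g _; exact: (measurable_image_act hT).
  rewrite -lte_fin -prE//; apply: lt_le_trans hmin _.
  apply: (@le_trans _ _ (\big[Order.min/+oo%E]_(i < k) mu (tower_union T B h n i))).
    by apply: ereal_inf_lbound; exists n.
  exact: bigmin_le_cond.
exact: (castles_partially_rigid hT mB hdisj hgen href delta0 hdelta k0 hna hsp herg).
Qed.
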